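(* Let $Q$ be a polynomial of degree $\le k$ (respectively, a homogeneous polynomial of degree $k$) on $\mathbb{R}^n$ and let $\omega=dx_1\wedge\cdots\wedge dx_n$ be the standard volume form on $\mathbb{R}^n$. Then the function $$F(\Delta)=\int_\Delta Q\omega$$ on the cone $C_s$ of strictly convex bodies $\Delta\subset\mathbb{R}^n$ with smooth boundaries is a polynomial of degree $\le k+n$ (respectively, a homogeneous polynomial of degree $k+n$).
   Context: $C_s$ is the cone, under Minkowski addition and multiplication by positive scalars, of strictly convex bodies with smooth boundary; strictly convex smooth is understood so that the support function $H_\Delta$ is smooth away from the origin and $\mathrm{grad}\,H_\Delta$ restricts to a smooth map $S^{n-1}\to\mathbb{R}^n$ with image $\partial\Delta$. A function $F$ on $C_s$ is a polynomial of degree $\le d$ (homogeneous of degree $d$) if for all $\Delta_1,\ldots,\Delta_r\in C_s$ the function $(\lambda_1,\ldots,\lambda_r)\mapsto F(\lambda_1\Delta_1+\cdots+\lambda_r\Delta_r)$, $\lambda_i>0$, is a polynomial of degree $\le d$ (homogeneous of degree $d$) in $\lambda_1,\ldots,\lambda_r$. *)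

(* Defs.v *)
From HB Require Import structures.
From mathcomp Require Import all_boot all_order all_algebra.
From mathcomp Require Import all_classical all_reals all_analysis.
(* The notations of mpoly clash with those of mathcomp-analysis. *)
From mathcomp Require mpoly.
Import (canonicals, coercions) mpoly.

Set Implicit Arguments.
Unset Strict Implicit.
Unset Printing Implicit Defensive.

Import Order.TTheory GRing.Theory Num.Theory.
Import numFieldNormedType.Exports.

Local Open Scope classical_set_scope.
Local Open Scope ring_scope.

Section measurable_rV.
Context {d} {T : sigmaRingType d} (n : nat).

Let coors : 'I_n -> 'rV[T]_n -> T := fun i v => v ord0 i.

Let rV_set0 : g_sigma_preimage coors set0.
Proof. exact: sigma_algebra0. Qed.

Let rV_setC A : g_sigma_preimage coors A -> g_sigma_preimage coors (~` A).
Proof. exact: sigma_algebraC. Qed.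

Let rV_bigcup (F : _^nat) : (forall i, g_sigma_preimage coors (F i)) ->
  g_sigma_preimage coors (\bigcup_i (F i)).
Proof. exact: sigma_algebra_bigcup. Qed.

(* The product sigma-algebra, as the library does for [n.-tuple T]; over the
   reals it is the Borel sigma-algebra. *)
HB.instance Definition _ := @isMeasurable.Build (measure_tuple_display d)
  'rV[T]_n (g_sigma_preimage coors) rV_set0 rV_setC rV_bigcup.

End measurable_rV.

Lemma measurable_coord_rV d (T : sigmaRingType d) n (i : 'I_n) :
  measurable_fun [set: 'rV[T]_n] (fun v => v ord0 i).
Proof.
move=> _ Y mY; rewrite setTI; apply: sub_sigma_algebra => /=.
rewrite -bigcup_seq/=; exists i => /=; first by rewrite mem_index_enum.
by exists Y => //; rewrite setTI.
Qed.

Lemma measurable_fun_rV d1 d2 (T1 : measurableType d1) (T2 : measurableType d2)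
    n (f : T1 -> 'rV[T2]_n) :
  (forall i, measurable_fun [set: T1] (fun x => f x ord0 i)) ->
  measurable_fun [set: T1] f.
Proof.
move=> mf; have key : g_sigma_preimage (fun i x => f x ord0 i) `<=` measurable.
  apply: smallest_sub; first exact: sigma_algebra_measurable.
  case: n f mf => [|n] f mf; first by rewrite big_ord0.
  rewrite -bigcup_mkord_ord; apply: bigcup_sub => i Ii.
  by move=> A [B mB <-]; exact: mf.
move=> _ A mA; apply: key.
by rewrite (g_sigma_preimage_comp (fun i (v : 'rV[T2]_n) => v ord0 i) f); exists A.
Qed.

(* Only a local fact in lebesgue_integral_fubini. *)
Lemma product_sigma_finite d1 d2 (T1 : measurableType d1)
    (T2 : measurableType d2) (R : realType)
    (m1 : {sigma_finite_measure set T1 -> \bar R})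
    (m2 : {sigma_finite_measure set T2 -> \bar R}) :
  sigma_finite [set: T1 * T2] (m1 \x m2)%E.
Proof.
have /sigma_finiteP[F [TF ndF Foo]] := sigma_finiteT m1.
have /sigma_finiteP[G [TG ndG Goo]] := sigma_finiteT m2.
exists (fun n => F n `*` G n).
  rewrite -setXTT TF TG predeqE => -[x y]; split.
    move=> [/= [n _ Fnx] [k _ Gky]]; exists (maxn n k) => //; split.
    - by move: x Fnx; exact/subsetPset/ndF/leq_maxl.
    - by move: y Gky; exact/subsetPset/ndG/leq_maxr.
  by move=> [n _ []/= ? ?]; split; exists n.
move=> k; have [? ?] := Foo k; have [? ?] := Goo k.
split; first exact: measurableX.
by rewrite product_measure1E// lte_mul_pinfty// ge0_fin_numE.
Qed.

Section lebesgue_rV.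
Context {R : realType}.

Definition cons_rV n (p : R * 'rV[R]_n) : 'rV[R]_n.+1 :=
  \row_j oapp (p.2 ord0) p.1 (unlift ord0 j).

(* n-dimensional Lebesgue measure, i.e. integration against the volume form
   dx_1 /\ ... /\ dx_n, as an iterated product of the one-dimensional one;
   R^0 carries the unit mass at its only point. *)
Fixpoint lebesgue_rV n : set 'rV[R]_n -> \bar R :=
  match n with
  | 0 => dirac (0 : 'rV[R]_0)
  | n.+1 => pushforward (lebesgue_measure \x @lebesgue_rV n)%E (@cons_rV n)
  end.
Arguments lebesgue_rV : clear implicits.

Let uncons_rV n (v : 'rV[R]_n.+1) : R * 'rV[R]_n :=
  (v ord0 ord0, \row_j v ord0 (lift ord0 j)).

Let cons_rV0 n (p : R * 'rV[R]_n) : cons_rV p ord0 ord0 = p.1.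
Proof. by rewrite mxE unlift_none. Qed.

Let cons_rVS n (p : R * 'rV[R]_n) j : cons_rV p ord0 (lift ord0 j) = p.2 ord0 j.
Proof. by rewrite mxE liftK. Qed.

Let cons_rVK n : cancel (@cons_rV n) (@uncons_rV n).
Proof.
case=> x v; rewrite /uncons_rV cons_rV0; congr pair.
by apply/rowP => j; rewrite mxE cons_rVS.
Qed.

Let measurable_cons_rV n : measurable_fun [set: R * 'rV[R]_n] (@cons_rV n).
Proof.
apply: measurable_fun_rV => i; have [j ->|->] := unliftP ord0 i.
  rewrite (_ : (fun _ => _) = (fun v : 'rV[R]_n => v ord0 j) \o snd); last first.
    by apply/funext => p /=; rewrite cons_rVS.
  by apply: measurableT_comp => //; exact: measurable_coord_rV.
rewrite (_ : (fun _ => _) = fst)//; apply/funext => p /=.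
by rewrite cons_rV0.
Qed.

Let measurable_uncons_rV n : measurable_fun [set: 'rV[R]_n.+1] (@uncons_rV n).
Proof.
apply: measurable_fun_pair; first exact: measurable_coord_rV.
apply: measurable_fun_rV => i.
rewrite (_ : (fun _ => _) = fun v : 'rV[R]_n.+1 => v ord0 (lift ord0 i)).
  exact: measurable_coord_rV.
by apply/funext => v; rewrite mxE.
Qed.

Let lebesgue_rV_ex n :
  exists mu : {sigma_finite_measure set 'rV[R]_n -> \bar R},
    lebesgue_rV n = mu.
Proof.
elim: n => [|n [mu /= ->]]; first by eexists.
pose nu : {measure set _ -> \bar R} := (@lebesgue_measure R \x mu)%E.
pose m : {measure set 'rV[R]_n.+1 -> \bar R} :=
  measure_function_pushforward__canonical__measure_function_Measure
    nu (@measurable_cons_rV n).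
have mE : m = pushforward nu (@cons_rV n) :> (set 'rV[R]_n.+1 -> \bar R) by [].
have sf : sigma_finite setT m.
  have [F FT Ffin] : sigma_finite setT nu by exact: product_sigma_finite.
  exists (fun i => @uncons_rV n @^-1` F i).
    by rewrite -preimage_bigcup -FT preimage_setT.
  move=> i; have [mF Foo] := Ffin i; split.
    by rewrite -[X in measurable X]setTI; exact: measurable_uncons_rV.
  rewrite mE /pushforward -comp_preimage.
  by rewrite (_ : _ \o _ = id)//; apply/funext; exact: cons_rVK.
pose M := Measure_isSigmaFinite.Build _ _ _ m sf.
pose m' : {sigma_finite_measure set _ -> \bar _} := HB.pack (Measure.sort m) M.
by exists m'.
Qed.

Let lebesgue_rV_set0 n : lebesgue_rV n set0 = 0%E.
Proof. by have [mu ->] := lebesgue_rV_ex n; rewrite measure0. Qed.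

Let lebesgue_rV_ge0 n A : (0 <= lebesgue_rV n A)%E.
Proof. by have [mu ->] := lebesgue_rV_ex n; exact: measure_ge0. Qed.

Let lebesgue_rV_sigma_additive n : semi_sigma_additive (lebesgue_rV n).
Proof.
by have [mu ->] := lebesgue_rV_ex n; exact: measure_semi_sigma_additive.
Qed.

HB.instance Definition _ n := isMeasure.Build _ _ _ (lebesgue_rV n)
  (@lebesgue_rV_set0 n) (@lebesgue_rV_ge0 n) (@lebesgue_rV_sigma_additive n).

Let lebesgue_rV_sigma_finite n : sigma_finite setT (lebesgue_rV n).
Proof. by have [mu ->] := lebesgue_rV_ex n; exact: sigma_finiteT. Qed.

HB.instance Definition _ n := Measure_isSigmaFinite.Build _ _ _
  (lebesgue_rV n) (@lebesgue_rV_sigma_finite n).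

Lemma measurable_box n (A : 'I_n -> set R) : (forall i, measurable (A i)) ->
  measurable [set v : 'rV[R]_n | forall i, A i (v ord0 i)].
Proof.
move=> mA; rewrite (_ : mkset _ =
    \bigcap_(i in [set: 'I_n]) (fun v : 'rV[R]_n => v ord0 i) @^-1` A i).
  apply: fin_bigcap_measurable => // i _.
  by rewrite -[X in measurable X]setTI; exact: measurable_coord_rV.
by apply/seteqP; split => v /= Av i => [_|]; exact: Av.
Qed.

Lemma lebesgue_rV_box n (A : 'I_n -> set R) : (forall i, measurable (A i)) ->
  lebesgue_rV n [set v | forall i, A i (v ord0 i)] =
  (\prod_(i < n) lebesgue_measure (A i))%E.
Proof.
elim: n A => [|n IH] A mA.
  by rewrite big_ord0 /= diracE mem_set// => -[].
rewrite big_ord_recl /= /pushforward.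
rewrite (_ : _ @^-1` _ = A ord0 `*`
    [set v : 'rV[R]_n | forall i, A (lift ord0 i) (v ord0 i)]).
  have mA' (i : 'I_n) : measurable (A (lift ord0 i)) by exact: mA.
  rewrite -IH//; apply: product_measure1E; first exact: (mA ord0).
  exact: (measurable_box mA').
apply/seteqP; split => -[x v] /=.
  move=> Av; split; first by have := Av ord0; rewrite cons_rV0.
  by move=> i; have := Av (lift ord0 i); rewrite cons_rVS.
move=> [Ax Av] i; have [j ->|->] := unliftP ord0 i.
  by rewrite cons_rVS; exact: Av.
by rewrite cons_rV0.
Qed.

End lebesgue_rV.
Arguments lebesgue_rV {R} n _.

Section smooth.
Context {R : realType} {V W : normedModType R}.

(* C^m on an open set U, through iterated directional derivatives. *)
Fixpoint continuously_differentiable (m : nat) (U : set V) (f : V -> W) :=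
  match m with
  | 0 => forall x, U x -> {for x, continuous f}
  | m.+1 => (forall x, U x -> differentiable f x) /\
            forall v, continuously_differentiable m U ('D_v f)
  end.

Definition smooth_on (U : set V) (f : V -> W) :=
  forall m, continuously_differentiable m U f.

End smooth.

Section convex_bodies.
Context {R : realType}.

Definition boundary {T : topologicalType} (A : set T) : set T :=
  closure A `\` A°.

Definition Minkowski_add {V : lmodType R} (A B : set V) : set V :=
  [set a + b | a in A & b in B].

Definition Minkowski_scale {V : lmodType R} (c : R) (A : set V) : set V :=
  [set c *: a | a in A].

Context {n : nat}.
Implicit Types A : set 'rV[R]_n.

Definition dotp (u v : 'rV[R]_n) : R := \sum_i u ord0 i * v ord0 i.

(* The norm of 'rV[R]_n in the library is the sup norm, so the Euclidean
   sphere is written with the scalar product. *)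
Definition unit_sphere : set 'rV[R]_n := [set u | dotp u u = 1].

Definition grad (f : 'rV[R]_n -> R) (u : 'rV[R]_n) : 'rV[R]_n :=
  \row_i 'D_(delta_mx ord0 i) f u.

Definition support_fun A (u : 'rV[R]_n) : R := sup [set dotp u x | x in A].

Definition convex_body A :=
  [/\ compact A, convex_set (A : set (convex_lmodType 'rV[R]_n)) & A° !=set0].

Definition strictly_convex A := forall x y (t : R), A x -> A y -> x != y ->
  0 < t -> t < 1 -> A° (t *: x + (1 - t) *: y).

(* Near each of its points the boundary is a regular level set of a smooth
   function. *)
Definition smooth_boundary A := forall p, boundary A p ->
  exists (U : set 'rV[R]_n) (g : 'rV[R]_n -> R),
    [/\ open U, U p, smooth_on U g, grad g p != 0 &
       forall x, U x -> (boundary A x <-> g x = 0)].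

(* The smoothness of the map grad H on the sphere is included in that of H. *)
Definition strictly_convex_smooth : set (set 'rV[R]_n) := [set A |
  [/\ convex_body A, strictly_convex A, smooth_boundary A,
      smooth_on [set~ 0] (support_fun A) &
      grad (support_fun A) @` unit_sphere = boundary A]].

End convex_bodies.

Section polynomials_on_a_cone.
Context {R : realType}.

(* [mpoly.msize p] is one more than the degree of [p], and 0 for [p = 0]. *)
Definition mpoly_degree_le n (d : nat) (p : mpoly.mpoly n R) :=
  (mpoly.msize p <= d.+1)%N.

Definition mpoly_homogeneous n (d : nat) (p : mpoly.mpoly n R) :=
  p \is mpoly.ishomog1 d mpoly.mdeg.

Context {V : lmodType R}.
Implicit Types (C : set (set V)) (F : set V -> R).

Definition Minkowski_comb r (lam : 'I_r -> R) (D : 'I_r -> set V) : set V :=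
  \big[Minkowski_add/[set 0]]_(i < r) Minkowski_scale (lam i) (D i).

(* F is only evaluated at combinations of r > 0 members of C: the empty one
   [set 0] need not belong to C. *)
Definition is_polynomial_with (P : forall r, mpoly.mpoly r R -> bool) C F :=
  forall r (D : 'I_r -> set V), (0 < r)%N -> (forall i, C (D i)) ->
  exists2 p : mpoly.mpoly r R, P r p &
    forall lam : 'I_r -> R, (forall i, 0 < lam i) ->
      F (Minkowski_comb lam D) = mpoly.meval lam p.

Definition polynomial_of_degree_le (d : nat) C F :=
  is_polynomial_with (fun r => @mpoly_degree_le r d) C F.

Definition homogeneous_polynomial (d : nat) C F :=
  is_polynomial_with (fun r => @mpoly_homogeneous r d) C F.

End polynomials_on_a_cone.

Definition integral_over {R : realType} n (Q : mpoly.mpoly n R)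
    (A : set 'rV[R]_n) : R :=
  \int[lebesgue_rV n]_(x in A) mpoly.meval (x ord0) Q.

(* Main.v *)
Require Import Defs.
From mathcomp Require Import all_boot all_order all_algebra.
From mathcomp Require Import all_classical all_reals all_analysis.
From mathcomp Require Import measurable_realfun.
From mathcomp Require Import ring.
From mathcomp Require mpoly.
Import (canonicals, coercions) mpoly.

Set Implicit Arguments.
Unset Strict Implicit.
Unset Printing Implicit Defensive.

Import Order.TTheory GRing.Theory Num.Theory.
Import numFieldNormedType.Exports.

Local Open Scope classical_set_scope.
Local Open Scope ring_scope.

(** The integral of a polynomial Q over the Minkowski combination of bodies
    D_1, ..., D_r with coefficients lam_i > 0 is polynomial in lam because, up
    to an arbitrarily small error, the combination can be cut into pieces that
    depend on lam through a linear map.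

    Suppose first that each D_i is the convex hull of finitely many generators.
    Lift a generator a of D_i to the vector (a, e_i) of dimension n + r.  Then x
    lies in the combination with coefficients lam exactly when (x, lam) is a
    nonnegative combination of lifted generators, i.e. when a linear program is
    feasible.  Give the generators generic costs.  For almost every x the
    cheapest representation of (x, lam) is supported by a basis, made of n + r
    generators; whether a basis is optimal does not depend on (x, lam), by
    duality; and no two optimal bases represent the same generic point
    ([optimal_cell_exists], [optimal_cell_unique]).  So the cells of the
    optimal bases tile the combination, and the set of these bases does not
    depend on lam.  Multiplying the coefficient of every generator of the i-th
    block by lam_i carries the cell of a basis at lam = (1, ..., 1) onto its
    cell at lam.  This map is affine in x and linear in lam, so that the change
    of variables formula writes the integral over the cell as the integral, over
    a fixed set, of a polynomial in lam of degree k + n: the degree k of Q plus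
    the degree n of the Jacobian determinant ([hpoly_slice]).

    Arbitrary compact convex bodies are then squeezed: the combination lies in
    polytopes of the above kind that lie in arbitrarily small neighbourhoods of
    it ([outer_polytopes]), so dominated convergence makes the integral a
    pointwise limit of homogeneous polynomials of a fixed degree.  Such a limit
    is a polynomial of the same kind, since polynomials of a given degree are
    determined, linearly, by finitely many of their values
    ([hpoly_interpolation]).  The same fact handles integrals of polynomials
    that depend on a parameter.

    Only monomials need to be integrated in this way: a homogeneous Q is a
    combination of monomials of one degree, and a Q of degree at most k of
    monomials of degree at most k. *)

(** * Homogeneous polynomial functions on the positive orthant *)

Section homogeneous_polynomial_functions.
Context {R : realType}.

(** A function in a finite-dimensional space is recovered, linearly, from its
    values at finitely many points.  The new pair (point, L) for an additional
    generator g is obtained from the error of the interpolation of g: where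
    that error vanishes identically nothing is needed, and otherwise it is
    normalized at a point where it does not vanish. *)
Lemma finite_interpolation (T : Type) (t0 : T) (P : set T) (V : set (T -> R))
    (e : nat -> T -> R) D :
  (forall f g c, V f -> V g -> V (fun x => f x + c * g x)) ->
  (forall i, (i < D)%N -> V (e i)) ->
  exists q (pt : nat -> T) (L : nat -> T -> R),
  [/\ forall j, (j < q)%N -> P (pt j), forall j, (j < q)%N -> V (L j) &
   forall f (c : nat -> R),
     (forall x, P x -> f x = \sum_(i < D) c i * e i x) ->
     forall x, P x -> f x = \sum_(j < q) f (pt j) * L j x].
Proof.
move=> Vlin; elim: D => [|D IH] Ve.
  exists 0%N, (fun=> t0), (fun _ _ => 0); split => // f c fE x Px.
  by rewrite fE// !big_ord0.
have [q [pt [L [Ppt VL HL]]]] := IH (fun i iD => Ve i (ltnW iD)).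
pose err x := e D x - \sum_(j < q) e D (pt j) * L j x.
have Verr m : (m <= q)%N -> V (fun x => e D x - \sum_(j < m) e D (pt j) * L j x).
  elim: m => [_|m IHm mq].
    rewrite (_ : (fun _ => _) = e D); first exact: Ve.
    by apply/funext => x; rewrite big_ord0 subr0.
  rewrite (_ : (fun _ => _) = (fun x =>
    (e D x - \sum_(j < m) e D (pt j) * L j x) + (- e D (pt m)) * L m x)).
    by apply: Vlin; [exact: IHm (ltnW mq)|exact: VL].
  by apply/funext => x; rewrite big_ord_recr/=; ring.
have lowE f (c : nat -> R) :
    (forall x, P x -> f x = \sum_(i < D.+1) c i * e i x) ->
    forall x, P x ->
    f x = \sum_(j < q) f (pt j) * L j x + c D * err x.
  move=> fE x Px; pose f' x := f x - c D * e D x.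
  have : forall x, P x -> f' x = \sum_(i < D) c i * e i x.
    by move=> y Py; rewrite /f' fE// big_ord_recr/= addrK.
  move/HL => /(_ x Px); rewrite /f' /err => /eqP.
  rewrite subr_eq => /eqP ->.
  under eq_bigr do rewrite mulrBl.
  rewrite sumrB mulrBr [c D * \sum_(_ < _) _]mulr_sumr.
  under [X in _ = _ + (_ - X)]eq_bigr do rewrite mulrA.
  by rewrite -addrA; congr +%R; rewrite addrC.
have [err0|[x0 [Px0 err_neq0]]] :
    (forall x, P x -> err x = 0) \/ (exists x, P x /\ err x != 0).
  have [|] := pselect (forall x, P x -> err x = 0); first by left.
  by move=> /existsNP[x /not_implyP[Px /eqP ex]]; right; exists x.
  exists q, pt, L; split => // f c fE x Px.
  by rewrite (lowE f c)// err0// mulr0 addr0.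
pose L' x := (err x0)^-1 * err x.
exists q.+1, (fun j => if j == q then x0 else pt j),
  (fun j x => if j == q then L' x else L j x - L j x0 * L' x); split.
- by move=> j; rewrite ltnS leq_eqVlt; case: eqVneq => //= _; exact: Ppt.
- move=> j; rewrite ltnS leq_eqVlt.
  have Ve' : V err by exact: Verr.
  case: eqVneq => //= [_ _|_ /VL Vj].
    rewrite /L' (_ : (fun _ => _) = (fun x => err x + ((err x0)^-1 - 1) * err x)).
      exact: Vlin.
    by apply/funext => x; ring.
  rewrite (_ : (fun _ => _) =
      (fun x => L j x + (- (L j x0 * (err x0)^-1)) * err x)).
    exact: Vlin.
  by apply/funext => x; rewrite /L'; ring.
- move=> f c fE x Px; rewrite big_ord_recr/= eqxx (lowE f c fE x0 Px0).
  rewrite (lowE f c fE x Px).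
  have -> : \sum_(i < q) f (if i == q :> nat then x0 else pt i) *
      (if i == q :> nat then L' x else L i x - L i x0 * L' x) =
    \sum_(i < q) f (pt i) * L i x - (\sum_(i < q) f (pt i) * L i x0) * L' x.
    rewrite mulr_suml -sumrB; apply: eq_bigr => i _.
    by rewrite (ltn_eqF (ltn_ord i)); ring.
  rewrite /L' -/err; field => //.
Qed.

Section hpoly.
Context {r : nat}.
Implicit Types (lam : 'I_r -> R) (G : ('I_r -> R) -> R).

Definition positive lam := forall i, 0 < lam i.

(** Only positive parameters are evaluated, so equality is required on the
    positive orthant alone. *)
Definition hpoly d G := exists2 p : mpoly.mpoly r R, mpoly_homogeneous d p &
  forall lam, positive lam -> G lam = mpoly.meval lam p.

Lemma eq_hpoly d G1 G2 : (forall lam, positive lam -> G1 lam = G2 lam) ->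
  hpoly d G1 -> hpoly d G2.
Proof. by move=> E [p hp pE]; exists p => // lam ?; rewrite -E// pE. Qed.

Lemma hpoly0 d : hpoly d (fun=> 0).
Proof.
by exists 0 => [|lam _]; [exact: mpoly.dhomog0|rewrite mpoly.meval0].
Qed.

Lemma hpoly_cst c : hpoly 0 (fun=> c).
Proof.
exists (c *: 1) => [|lam _]; last by rewrite mpoly.mevalZ mpoly.meval1 mulr1.
by apply: mpoly.dhomogZ; exact: mpoly.dhomog1.
Qed.

Lemma hpoly_coord i : hpoly 1 (fun lam => lam i).
Proof.
exists (mpoly.mpolyX R (mpoly.mnm1 i)) => [|lam _].
  by rewrite /mpoly_homogeneous mpoly.dhomogX /= mpoly.mdeg1.
by rewrite mpoly.mevalXU.
Qed.

Lemma hpolyD d G1 G2 : hpoly d G1 -> hpoly d G2 ->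
  hpoly d (fun lam => G1 lam + G2 lam).
Proof.
move=> [p hp pE] [q hq qE]; exists (p + q); first exact: mpoly.dhomogD.
by move=> lam ?; rewrite mpoly.mevalD pE// qE.
Qed.

Lemma hpolyM d e G1 G2 : hpoly d G1 -> hpoly e G2 ->
  hpoly (d + e) (fun lam => G1 lam * G2 lam).
Proof.
move=> [p hp pE] [q hq qE]; exists (p * q); first exact: mpoly.dhomogM.
by move=> lam ?; rewrite mpoly.mevalM pE// qE.
Qed.

Lemma hpolyZ d c G : hpoly d G -> hpoly d (fun lam => c * G lam).
Proof. by move=> hG; rewrite -[d]add0n; apply: hpolyM => //; exact: hpoly_cst. Qed.

Lemma hpoly_sum d (I : Type) (s : seq I) (P : pred I) (G : I -> _ -> R) :
  (forall i, P i -> hpoly d (G i)) ->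
  hpoly d (fun lam => \sum_(i <- s | P i) G i lam).
Proof.
move=> hG; elim: s => [|i s IH].
  by apply: eq_hpoly (hpoly0 d) => lam _; rewrite big_nil.
apply: (@eq_hpoly _ (fun lam => (if P i then G i lam else 0) +
  \sum_(i <- s | P i) G i lam)) => [lam _|].
  by rewrite big_cons; case: ifP; rewrite ?add0r.
by apply: hpolyD => //; case Pi: (P i); [exact: hG|exact: hpoly0].
Qed.

Lemma hpoly_prod (I : Type) (s : seq I) (d : I -> nat) (G : I -> _ -> R) :
  (forall i, hpoly (d i) (G i)) ->
  hpoly (\sum_(i <- s) d i) (fun lam => \prod_(i <- s) G i lam).
Proof.
move=> hG; elim: s => [|i s IH].
  by rewrite big_nil; apply: eq_hpoly (hpoly_cst 1) => lam _; rewrite big_nil.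
rewrite big_cons; apply: eq_hpoly (hpolyM (hG i) IH) => lam _.
by rewrite big_cons.
Qed.

Lemma hpolyX d k G : hpoly d G -> hpoly (k * d) (fun lam => G lam ^+ k).
Proof.
move=> hG; have := hpoly_prod (index_enum 'I_k) (fun=> hG).
rewrite [X in hpoly X _]sum_nat_const card_ord; apply: eq_hpoly => lam _.
by rewrite [LHS]prodr_const card_ord.
Qed.

Lemma hpoly_det d n (M : ('I_r -> R) -> 'M[R]_n) :
  (forall i j, hpoly d (fun lam => M lam i j)) ->
  hpoly (n * d) (fun lam => \det (M lam)).
Proof.
move=> hM; rewrite /determinant; apply: hpoly_sum => s _; apply: hpolyZ.
rewrite -[n in (n * d)%N]card_ord -sum_nat_const.
exact: hpoly_prod.
Qed.

(** The monomials of degree d span the space that is interpolated. *)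
Lemma hpoly_interpolation d : exists q (pt : nat -> 'I_r -> R) L,
  [/\ forall j, (j < q)%N -> positive (pt j),
      forall j, (j < q)%N -> hpoly d (L j) &
   forall G, hpoly d G -> forall lam, positive lam ->
     G lam = \sum_(j < q) G (pt j) * L j lam].
Proof.
pose e := map val [seq m <- index_enum (mpoly.bmultinom r d.+1) |
  mpoly.mdeg (val m) == d].
pose m i := nth mpoly.mnm0 e i.
have [|i ie|q [pt [L [Ppt VL HL]]]] := @finite_interpolation _ (fun=> 1) positive
   (hpoly d) (fun i lam => mpoly.meval lam (mpoly.mpolyX R (m i))) (size e).
- by move=> f g c hf hg; apply: hpolyD => //; exact: hpolyZ.
- exists (mpoly.mpolyX R (m i)) => //.
  have /mapP[b] := mem_nth mpoly.mnm0 ie.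
  rewrite mem_filter => /andP[mb _] E.
  by rewrite /mpoly_homogeneous mpoly.dhomogX /m E.
exists q, pt, L; split => // G [p hp pE].
apply: (HL _ (fun i => mpoly.mcoeff (m i) p)) => lam lam0; rewrite pE//.
have mp : (mpoly.msize p <= d.+1)%N.
  rewrite mpoly.msizeE; apply/bigmax_leqP_seq => b bp _.
  by rewrite (mpoly.dhomog_mf hp bp).
rewrite {1}(mpoly.mpolywE mp) raddf_sum.
under eq_bigr do rewrite /= mpoly.mevalZ.
rewrite (bigID (fun b : mpoly.bmultinom r d.+1 => mpoly.mdeg (val b) == d))/=.
rewrite [X in _ + X]big1 ?addr0; last first.
  by move=> b bd; rewrite (mpoly.dhomog_nemf_coeff hp bd) mul0r.
transitivity (\sum_(b <- e) mpoly.mcoeff b p *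
    mpoly.meval lam (mpoly.mpolyX R b)).
  by rewrite /e big_map big_filter.
by rewrite (big_nth mpoly.mnm0) big_mkord.
Qed.

End hpoly.
End homogeneous_polynomial_functions.

Lemma Rintegral_sum d (X : measurableType d) (R : realType)
    (mu : {measure set X -> \bar R}) (D : set X) (I : eqType) (s : seq I)
    (f : I -> X -> R) : measurable D ->
  (forall i, i \in s -> mu.-integrable D (EFin \o f i)) ->
  mu.-integrable D (fun x => (\sum_(i <- s) f i x)%:E) /\
  \int[mu]_(x in D) (\sum_(i <- s) f i x) = \sum_(i <- s) \int[mu]_(x in D) f i x.
Proof.
move=> mD; elim: s => [_|i s IH intf].
  under eq_fun do rewrite big_nil; split; first exact: integrable0.
  by under eq_Rintegral do rewrite big_nil; rewrite big_nil /Rintegral integral0.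
have inti := intf i (mem_head i s).
have [|ints E] := IH; first by move=> j js; apply: intf; rewrite in_cons js orbT.
under eq_fun do rewrite big_cons EFinD; split; first exact: integrableD.
by under eq_Rintegral do rewrite big_cons; rewrite RintegralD// E big_cons.
Qed.

Section hpoly_limits.
Context {R : realType} {r : nat}.
Implicit Types (lam : 'I_r -> R) (G : ('I_r -> R) -> R).

(** A function of the space is a fixed linear combination of its values at
    finitely many points, an expression that passes to pointwise limits. *)
Lemma hpoly_cvg d (G_ : nat -> ('I_r -> R) -> R) G : (forall k, hpoly d (G_ k)) ->
  (forall lam, positive lam -> G_ k lam @[k --> \oo] --> G lam) -> hpoly d G.
Proof.
move=> hG_ G_G; have [q [pt [L [pt0 hL LE]]]] := @hpoly_interpolation R r d.
suff GE lam : positive lam -> \sum_(j < q) G (pt j) * L j lam = G lam.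
  apply: eq_hpoly GE _; apply: hpoly_sum => j _; apply: hpolyZ.
  exact/hL/ltn_ord.
move=> lam0; apply: cvg_unique (G_G _ lam0) => //.
rewrite (_ : (fun k => _) = fun k => \sum_(j < q) G_ k (pt j) * L j lam); last first.
  by apply/funext => k; exact: LE.
apply: cvg_big => [|j _]; first exact: add_continuous.
by apply: cvgM; [exact: G_G (pt0 _ (ltn_ord j))|exact: cvg_cst].
Qed.

(** The integrand, as a combination of its values at finitely many parameters
    with coefficients that do not depend on x, can be integrated term by term. *)
Lemma hpoly_Rintegral d dX (X : measurableType dX)
    (mu : {measure set X -> \bar R}) (D : set X) (g : ('I_r -> R) -> X -> R) :
  measurable D -> (forall x, D x -> hpoly d (g ^~ x)) ->
  (forall lam, positive lam -> mu.-integrable D (EFin \o g lam)) ->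
  hpoly d (fun lam => \int[mu]_(x in D) g lam x).
Proof.
move=> mD hg ig; have [q [pt [L [pt0 hL LE]]]] := @hpoly_interpolation R r d.
apply: (@eq_hpoly _ _ _
  (fun lam => \sum_(j < q) (\int[mu]_(x in D) g (pt j) x) * L j lam)); last first.
  by apply: hpoly_sum => j _; apply: hpolyZ; exact/hL/ltn_ord.
move=> lam lam0; rewrite (@eq_Rintegral _ _ _ _ _
    (fun x => \sum_(j < q) g (pt j) x * L j lam)); last first.
  by move=> x /set_mem Dx; exact: (LE _ (hg x Dx)).
have intpt (j : 'I_q) : mu.-integrable D (EFin \o g (pt j)).
  by apply: ig; exact/pt0/ltn_ord.
rewrite (Rintegral_sum mD _).2.
  by apply: eq_bigr => j _; rewrite RintegralZr.
move=> j _; rewrite (_ : _ \o _ = fun x => ((L j lam)%:E * (g (pt j) x)%:E)%E).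
  exact: integrableZl (intpt j).
by apply/funext => x /=; rewrite mulrC EFinM.
Qed.
End hpoly_limits.

(** * Linear change of variables *)

Section lebesgue_affine.
Context {R : realType}.
Implicit Types f : R -> \bar R.

(** The image of Lebesgue measure, scaled by the slope, is the length on
    half-open intervals, which determine the measure. *)
Lemma ge0_integral_lebesgue_affine (a b : R) f : a != 0 ->
  measurable_fun setT f -> (forall x, (0 <= f x)%E) ->
  (\int[lebesgue_measure]_x f x =
   (`|a| : R)%:E * \int[lebesgue_measure]_x f (x * a + b)%R)%E.
Proof.
move=> a0 mf f0; pose phi (x : measurableTypeR R) : measurableTypeR R := ((x : R) * a + b)%R.
have mphi : measurable_fun setT (phi : R -> R).
  by apply: measurable_funD => //; exact: measurable_funM.
pose push : {measure set (measurableTypeR R) -> \bar R} :=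
  measure_function_pushforward__canonical__measure_function_Measure
    (@lebesgue_measure R) (mphi : measurable_fun [set: measurableTypeR R] phi).
pose nu := mscale (NngNum (normr_ge0 a)) push.
transitivity (\int[nu]_x f x)%E.
  apply: eq_measure_integral => A mA _.
  apply: lebesgue_measure_unique => // _ [[u v] _ <-] /=.
  rewrite /nu /mscale/= /pushforward/=.
  have [a_gt0|a_lt0|aE] := ltgtP 0 a; last by rewrite -aE eqxx in a0.
    rewrite (_ : phi @^-1` _ = `](u - b) / a, (v - b) / a]%classic); last first.
      apply/seteqP; split => x /=; rewrite !in_itv/= /phi ltr_pdivrMr//
        ler_pdivlMr// ltrBlDr lerBrDr//.
    rewrite !lebesgue_measure_itv/= !lte_fin ltr_pM2r ?invr_gt0// ltrD2r.
    case: ifPn => uv; last by rewrite mule0.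
    by rewrite -EFinB -EFinM gtr0_norm//; congr EFin; field.
  rewrite (_ : phi @^-1` _ = `[(v - b) / a, (u - b) / a[%classic); last first.
    apply/seteqP; split => x /=; rewrite !in_itv/= /phi andbC ler_ndivrMr//
      ltr_ndivlMr// ltrBlDr lerBrDr//.
  rewrite !lebesgue_measure_itv/= !lte_fin ltr_nM2r ?invr_lt0// ltrD2r.
  case: ifPn => uv; last by rewrite mule0.
  by rewrite -EFinB -EFinM ltr0_norm//; congr EFin; field.
rewrite ge0_integral_mscale//=; congr (_ * _)%E.
by rewrite ge0_integral_pushforward.
Qed.

End lebesgue_affine.

Section lebesgue_rV_linear.
Context {R : realType}.
Local Open Scope ereal_scope.

Lemma cons_rVE n (x : R) (w : 'rV[R]_n) :
  cons_rV (x, w) = row_mx (x%:M : 'M[R]_1) w :> 'rV[R]_(1 + n).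
Proof.
apply/rowP => j; rewrite !mxE; case: (split_ordP j) => k ->.
  rewrite (ord1 k) (_ : lshift n ord0 = ord0) ?unlift_none/=; last exact: val_inj.
  by rewrite mxE eqxx mulr1n.
by rewrite (_ : rshift 1 k = lift ord0 k) ?liftK//; exact: val_inj.
Qed.

Lemma mul_cons_rV_block n x (w : 'rV[R]_n) (a : 'M[R]_1) (b : 'rV[R]_n)
    (C : 'cV[R]_n) (D : 'M[R]_n) :
  ((cons_rV (x, w) : 'rV[R]_(1 + n)) *m block_mx a b C D =
   row_mx (x *: a + w *m C) (x *: b + w *m D))%R.
Proof. by rewrite cons_rVE mul_row_block !mul_scalar_mx. Qed.

Lemma measurable_cons_rV n : measurable_fun setT (@cons_rV R n).
Proof.
apply: measurable_fun_rV => i; have [j ->|->] := unliftP ord0 i.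
  rewrite (_ : (fun _ => _) = (fun v : 'rV[R]_n => v ord0 j) \o snd).
    by apply: measurableT_comp => //; exact: measurable_coord_rV.
  by apply/funext => p /=; rewrite mxE liftK.
rewrite (_ : (fun _ => _) = fst)//; apply/funext => p /=.
by rewrite mxE unlift_none.
Qed.

Lemma measurable_affine_rV n m (M : 'M[R]_(n, m)) (c : 'rV[R]_m) :
  measurable_fun setT (fun v : 'rV[R]_n => (v *m M + c)%R).
Proof.
apply: measurable_fun_rV => j.
rewrite (_ : (fun _ => _) =
    fun v : 'rV[R]_n => ((\sum_i v ord0 i * M i j) + c ord0 j)%R).
  apply: measurable_funD => //; apply: measurable_sum => i.
  by apply: measurable_funM => //; exact: measurable_coord_rV.
by apply/funext => v; rewrite !mxE.
Qed.

Section tonelli.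
Context {n : nat} (f : 'rV[R]_n.+1 -> \bar R).
Hypotheses (mf : measurable_fun setT f) (f0 : forall v, 0 <= f v).

Let mfc : measurable_fun setT (f \o @cons_rV R n).
Proof. by apply: measurableT_comp => //; exact: measurable_cons_rV. Qed.

Let integral_uncons : \int[lebesgue_rV n.+1]_v f v =
  \int[lebesgue_measure \x lebesgue_rV n]_p f (cons_rV p).
Proof.
pose nu : {measure set (measurableTypeR R * 'rV[R]_n) -> \bar R} :=
  lebesgue_measure \x lebesgue_rV n.
have mcons : measurable_fun [set: measurableTypeR R * 'rV[R]_n] (@cons_rV R n).
  exact: measurable_cons_rV.
have := ge0_integral_pushforward mcons nu measurableT mf (fun v _ => f0 v).
by rewrite preimage_setT.
Qed.

Lemma ge0_integral_lebesgue_rVS : \int[lebesgue_rV n.+1]_v f v =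
  \int[lebesgue_measure]_x \int[lebesgue_rV n]_w f (cons_rV (x, w)).
Proof.
rewrite integral_uncons; apply: (@fubini_tonelli1 _ _ (measurableTypeR R) _ R
  lebesgue_measure (lebesgue_rV n) (f \o @cons_rV R n)) => //.
by move=> p /=.
Qed.

Lemma ge0_integral_lebesgue_rVS_swap : \int[lebesgue_rV n.+1]_v f v =
  \int[lebesgue_rV n]_w \int[lebesgue_measure]_x f (cons_rV (x, w)).
Proof.
rewrite integral_uncons; apply: (@fubini_tonelli2 _ _ (measurableTypeR R) _ R
  lebesgue_measure (lebesgue_rV n) (f \o @cons_rV R n)) => //.
by move=> p /=.
Qed.

Lemma measurable_integral_cons2 :
  measurable_fun setT (fun x => \int[lebesgue_rV n]_w f (cons_rV (x, w))).
Proof.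
apply: (@measurable_fun_fubini_tonelli_F _ _ (measurableTypeR R) _ R
  (lebesgue_rV n) (f \o @cons_rV R n)) => //.
by move=> p /=.
Qed.

Lemma measurable_integral_cons1 :
  measurable_fun setT (fun w => \int[lebesgue_measure]_x f (cons_rV (x, w))).
Proof.
apply: (@measurable_fun_fubini_tonelli_G _ _ (measurableTypeR R) _ R
  lebesgue_measure (f \o @cons_rV R n)) => //.
by move=> p /=.
Qed.

Lemma measurable_cons2 x : measurable_fun setT (fun w => f (cons_rV (x, w))).
Proof. exact: (measurableT_comp mfc (pair1_measurable x)). Qed.

Lemma measurable_cons1 w : measurable_fun setT (fun x => f (cons_rV (x, w))).
Proof. exact: (measurableT_comp mfc (pair2_measurable w)). Qed.

End tonelli.

(** With the determinant on the side of the substituted integrand, such formulas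
    compose by multiplication, without inverses. *)
Definition substitution n (M : 'M[R]_n) (c : 'rV[R]_n) :=
  forall f : 'rV[R]_n -> \bar R, measurable_fun setT f -> (forall v, 0 <= f v) ->
  \int[lebesgue_rV n]_v f v =
  `|\det M : R|%R%:E * \int[lebesgue_rV n]_v f (v *m M + c)%R.

Lemma substitution_mul n (M N : 'M[R]_n) c :
  substitution M 0 -> substitution N c -> substitution (M *m N) c.
Proof.
move=> hM hN f mf f0; rewrite hN// (hM (fun v => f (v *m N + c)%R))//.
  rewrite det_mulmx normrM EFinM [LHS]muleA [X in _ = X * _]muleC.
  by under eq_integral do rewrite addr0 -mulmxA.
by apply: measurableT_comp => //; exact: measurable_affine_rV.
Qed.

(** Integrating over the first coordinate before the others reduces a shear of
    the first coordinate to the one-dimensional formula. *)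
Lemma substitution_lower n (a : R) (C : 'cV[R]_n) : a != 0%R ->
  substitution (block_mx a%:M 0 C 1%:M : 'M[R]_(1 + n)) 0.
Proof.
move=> a0 f mf f0; set L := block_mx _ _ _ _.
have mfL : measurable_fun setT (fun v : 'rV[R]_n.+1 => f (v *m L + 0)%R).
  by apply: measurableT_comp => //; exact: measurable_affine_rV.
rewrite (ge0_integral_lebesgue_rVS_swap mfL)// ge0_integral_lebesgue_rVS_swap//.
rewrite det_lblock det1 mulr1 det_scalar1 -ge0_integralZl//; last 2 first.
- exact: (measurable_integral_cons1 mfL (fun=> f0 _)).
- by move=> w _; exact: integral_ge0.
apply: eq_integral => w _.
rewrite (ge0_integral_lebesgue_affine ((w *m C)%R ord0 ord0) a0)//; last first.
  exact: measurable_cons1.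
congr (_ * _); apply: eq_integral => x _; rewrite addr0; congr f.
rewrite mul_cons_rV_block cons_rVE scaler0 add0r mulmx1; congr row_mx.
by apply/rowP => j; rewrite (ord1 j) !mxE !eqxx !mulr1n.
Qed.

(** Here the first coordinate is integrated last: for a fixed value of it the
    map is affine in the other coordinates. *)
Lemma substitution_upper n (b : 'rV[R]_n) (D : 'M[R]_n) c :
  (forall c', substitution D c') ->
  substitution (block_mx 1%:M b 0 D : 'M[R]_(1 + n)) c.
Proof.
move=> hD f mf f0; set U := block_mx _ _ _ _.
have mfU : measurable_fun setT (fun v : 'rV[R]_n.+1 => f (v *m U + c)%R).
  by apply: measurableT_comp => //; exact: measurable_affine_rV.
rewrite (ge0_integral_lebesgue_rVS mfU)// ge0_integral_lebesgue_rVS//.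
pose c1 := lsubmx (c : 'rV_(1 + n)); pose c2 := rsubmx (c : 'rV_(1 + n)).
rewrite det_ublock det1 mul1r.
rewrite (ge0_integral_lebesgue_affine (c1 ord0 ord0) (oner_neq0 R)); last 2 first.
- exact: measurable_integral_cons2.
- by move=> x; exact: integral_ge0.
rewrite normr1 mul1e -ge0_integralZl//; last 2 first.
- exact: (measurable_integral_cons2 mfU (fun=> f0 _)).
- by move=> w _; exact: integral_ge0.
apply: eq_integral => x _.
rewrite (hD (x *: b + c2)%R)//; last exact: measurable_cons2.
congr (_ * _); apply: eq_integral => w _; congr f.
rewrite mul_cons_rV_block cons_rVE mulmx0 addr0 -[in RHS](hsubmxK c).
rewrite [RHS]add_row_mx; congr row_mx.
  by apply/rowP => j; rewrite (ord1 j) !mxE !eqxx !mulr1n mulr1.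
by rewrite addrA [(w *m D + _)%R]addrC.
Qed.

(** Gaussian elimination: a matrix with nonzero corner is the product of a lower
    and an upper block matrix, the latter with the Schur complement as its
    corner, and a row operation makes the corner of any invertible matrix
    nonzero. *)
Lemma substitution_unitmx n (M : 'M[R]_n) c : M \in unitmx -> substitution M c.
Proof.
elim: n M c => [|n IH] M c uM.
  move=> f mf f0; rewrite det_mx00 normr1 mul1e; apply: eq_integral => v _.
  by congr f; apply/rowP; case.
have corner (N : 'M[R]_(1 + n)) c' : N \in unitmx ->
    ulsubmx N ord0 ord0 != 0%R -> substitution N c'.
  move=> uN; set a := ulsubmx N ord0 ord0 => a0.
  set b := ursubmx N; set C := dlsubmx N; set D := drsubmx N.
  pose D' := (D - C *m (a^-1 *: b))%R.
  have NE : N = (block_mx a%:M 0 C 1%:M : 'M[R]_(1 + n)) *m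
                block_mx 1%:M (a^-1 *: b) 0 D'.
    rewrite mulmx_block !mulmx0 !mul0mx !mulmx1 !mul1mx !addr0 mul_scalar_mx.
    rewrite scalerA mulfV// scale1r addrC subrK -[LHS]submxK; congr block_mx.
    exact: mx11_scalar.
  have uD' : D' \in unitmx.
    move: uN; rewrite NE unitmx_mul => /andP[_].
    by rewrite !unitmxE det_ublock det1 mul1r.
  rewrite NE; apply: substitution_mul; first exact: substitution_lower.
  by apply: substitution_upper => c2; exact: IH.
have [a0|] := eqVneq (ulsubmx (M : 'M[R]_(1 + n)) ord0 ord0) 0%R; last exact: corner.
have [i Ci0] : exists i, dlsubmx (M : 'M[R]_(1 + n)) i ord0 != 0%R.
  apply/existsP; apply: contraTT uM => /existsPn C0.
  have dl0 : dlsubmx (M : 'M[R]_(1 + n)) = 0%R.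
    by apply/matrixP => i j; rewrite (ord1 j) [RHS]mxE; apply/eqP/negPn/C0.
  rewrite unitmxE -[\det M]/(\det (M : 'M[R]_(1 + n))).
  rewrite -(submxK (M : 'M[R]_(1 + n))) dl0 det_ublock.
  by rewrite [ulsubmx _]mx11_scalar a0 det_scalar1 mul0r unitr0.
set C := dlsubmx _ in Ci0.
pose u : 'rV[R]_n := ((C i ord0)^-1 *: delta_mx ord0 i)%R.
have uC : (u *m C)%R ord0 ord0 = 1%R.
  by rewrite /u -scalemxAl -rowE mxE [row _ _ _ _]mxE mulVf.
pose U s : 'M[R]_(1 + n) := block_mx 1%:M (s *: u)%R 0 1%:M.
have uU s : U s \in unitmx by rewrite unitmxE det_ublock !det1 mulr1 unitr1.
have -> : M = U (-1)%R *m (U 1%R *m M).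
  rewrite mulmxA mulmx_block !mulmx0 !mul0mx !mulmx1 !mul1mx !addr0 add0r.
  by rewrite scale1r scaleN1r subrr -scalar_mx_block mul1mx.
apply: substitution_mul.
  by apply: substitution_upper => c2; apply: IH; exact: unitmx1.
apply: (corner (U 1%R *m (M : 'M[R]_(1 + n)))); first by rewrite unitmx_mul uU.
rewrite -[X in _ *m X](submxK (M : 'M[R]_(1 + n))) mulmx_block block_mxKul mul1mx scale1r.
by rewrite mxE a0 add0r uC oner_eq0.
Qed.

End lebesgue_rV_linear.

Section lebesgue_rV_consequences.
Context {R : realType}.

Lemma measurable_dotmx n (p : 'cV[R]_n) (c : R) :
  measurable_fun setT (fun v : 'rV[R]_n => (v *m p) ord0 ord0 + c).
Proof.
apply: measurable_funD => //.
rewrite (_ : (fun _ => _) =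
    (fun w : 'rV[R]_1 => w ord0 ord0) \o (fun v : 'rV[R]_n => v *m p + 0)).
  apply: measurableT_comp; first exact: measurable_coord_rV.
  exact: measurable_affine_rV.
by apply/funext => v /=; rewrite addr0.
Qed.

Lemma measurable_hyperplane n (p : 'cV[R]_n) (c : R) :
  measurable [set v : 'rV[R]_n | (v *m p) ord0 ord0 + c = 0].
Proof.
rewrite -[X in measurable X]setTI.
exact: (measurable_dotmx p c measurableT (measurable_set1 0)).
Qed.

(** If the equation involves a coordinate other than the first, all the slices
    at a given first coordinate are hyperplanes; otherwise the lines parallel to
    the first axis meet the set in a single point. *)
Lemma lebesgue_rV_hyperplane n (p : 'cV[R]_n) (c : R) : p != 0 ->
  lebesgue_rV n [set v | (v *m p) ord0 ord0 + c = 0] = 0%E.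
Proof.
elim: n p c => [|n IH] p c p0.
  by move: p0; rewrite (flatmx0 p) eqxx.
pose H := [set v : 'rV[R]_n.+1 | (v *m p) ord0 ord0 + c = 0].
have mH : measurable H := measurable_hyperplane p c.
have mfH : measurable_fun setT (fun v => (\1_H v)%:E : \bar R).
  by apply/measurable_EFinP; exact: measurable_indic.
have fH0 v : (0 <= (\1_H v)%:E :> \bar R)%E by rewrite lee_fin.
transitivity (\int[lebesgue_rV n.+1]_v (\1_H v)%:E)%E.
  by rewrite integral_indic// setIT.
pose P : 'cV[R]_(1 + n) := p.
have consE x w : H (cons_rV (x, w)) <->
    (w *m dsubmx P) ord0 ord0 + (x * usubmx P ord0 ord0 + c) = 0.
  have consP : (cons_rV (x, w) : 'rV[R]_(1 + n)) *m P =
      x *: usubmx P + w *m dsubmx P.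
    by rewrite -{1}[P]vsubmxK cons_rVE mul_row_col mul_scalar_mx.
  rewrite /H /= -[p]/P [_ *m P]consP mxE [X in X + _ + _]mxE.
  by rewrite addrAC [in X in _ <-> X]addrC.
have [dP0|dP0] := eqVneq (dsubmx P) 0.
  have uP0 : usubmx P ord0 ord0 != 0.
    apply: contraNneq p0 => uP0; rewrite -[p]/P -[P]vsubmxK dP0.
    rewrite [usubmx P]mx11_scalar uP0.
    by rewrite raddf0 col_mx0.
  rewrite (ge0_integral_lebesgue_rVS_swap mfH)// integral0_eq// => w _.
  pose z := - c / usubmx P ord0 ord0.
  transitivity (\int[lebesgue_measure]_x (\1_[set z] x)%:E : \bar R)%E; last first.
    by rewrite integral_indic// setIT; exact: lebesgue_measure_set1.
  apply: eq_integral => x _.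
  congr EFin; rewrite !indicE; congr (nat_of_bool _)%:R.
  apply/idP/idP => /set_mem; rewrite ?consE => h; apply/mem_set.
    move: h; rewrite /= dP0 mulmx0 mxE add0r /z => /eqP; rewrite addr_eq0 => /eqP xE.
    by apply/eqP; rewrite eq_sym -xE mulfK.
  by apply/consE; rewrite h dP0 mulmx0 mxE add0r /z mulfVK ?addNr.
rewrite (ge0_integral_lebesgue_rVS mfH)// integral0_eq// => x _.
rewrite -[RHS](IH _ (x * usubmx P ord0 ord0 + c) dP0).
set H' := (X in lebesgue_rV n X).
have mH' : measurable H' by exact: measurable_hyperplane.
transitivity (\int[lebesgue_rV n]_w (\1_H' w)%:E)%E; last first.
  by rewrite integral_indic// setIT.
apply: eq_integral => w _; congr EFin; rewrite !indicE; congr (nat_of_bool _)%:R.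
by apply/idP/idP => /set_mem/consE/mem_set.
Qed.

Lemma measurable_preimage_affine n (M : 'M[R]_n) c (D : set 'rV[R]_n) :
  measurable D -> measurable [set v | D (v *m M + c)].
Proof.
by move=> mD; rewrite -[X in measurable X]setTI; exact: measurable_affine_rV.
Qed.

Lemma ge0_integral_substitution n (M : 'M[R]_n) c (D : set 'rV[R]_n)
    (h : 'rV[R]_n -> \bar R) : M \in unitmx -> measurable D ->
  measurable_fun setT h -> (forall v, 0 <= h v)%E ->
  (\int[lebesgue_rV n]_(v in D) h v = (`|\det M : R|%R)%:E *
    \int[lebesgue_rV n]_(v in [set v | D (v *m M + c)%R]) h (v *m M + c)%R)%E.
Proof.
move=> uM mD mh h0; rewrite integral_mkcond (substitution_unitmx c uM).
- by rewrite [in RHS]integral_mkcond; congr (_ * _)%E.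
- by apply/(measurable_restrictT _ mD); exact: measurable_funTS.
- by move=> v; rewrite /patch; case: ifP.
Qed.

(** The formula for nonnegative functions is applied to the positive and the
    negative part; integrability makes their integrals finite. *)
Lemma Rintegral_substitution n (M : 'M[R]_n) c (D : set 'rV[R]_n)
    (g : 'rV[R]_n -> R) : M \in unitmx -> measurable D -> measurable_fun setT g ->
  (lebesgue_rV n).-integrable [set v | D (v *m M + c)]
    (fun v => (g (v *m M + c))%:E) ->
  \int[lebesgue_rV n]_(v in D) g v =
  `|\det M : R| * \int[lebesgue_rV n]_(v in [set v | D (v *m M + c)]) g (v *m M + c).
Proof.
move=> uM mD mg ig; have mD' := measurable_preimage_affine M c mD.
have mgE : measurable_fun setT (fun v => (g v)%:E) by apply/measurable_EFinP.
rewrite /Rintegral integralE.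
rewrite (ge0_integral_substitution c uM mD (measurable_funepos mgE))//.
rewrite (ge0_integral_substitution c uM mD (measurable_funeneg mgE))//.
rewrite [in RHS]integralE.
rewrite [X in (_ * X - _)%E](eq_integral (fun v => (g (v *m M + c))%:E)^\+%E); last first.
  by move=> v _; rewrite !funeposE.
rewrite [X in (_ - _ * X)%E](eq_integral (fun v => (g (v *m M + c))%:E)^\-%E); last first.
  by move=> v _; rewrite !funenegE.
move: (integrable_pos_fin_num mD' ig) (integrable_neg_fin_num mD' ig).
move: (integral _ _ _) (integral _ _ _) => [p| |] [q| |]//= _ _.
by rewrite mulrBr.
Qed.

End lebesgue_rV_consequences.

(** * Optimal bases of a nondegenerate linear program *)

Section cells.
Context {R : realFieldType} (n r : nat) (T : finType) (t0 : T).
Context (a : T -> 'rV[R]_n) (beta : T -> 'I_r).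
Implicit Types (S : {set T}) (y v w : T -> R) (z : 'rV[R]_(n + r)) (t : T).

(** A generator remembers its block in the last r coordinates; a nonnegative
    combination of generators thus determines a point together with the
    coefficients of the Minkowski combination that contains it. *)
Definition generator t : 'rV[R]_(n + r) := row_mx (a t) (delta_mx ord0 (beta t)).

Definition nonneg_comb y z := (forall t, 0 <= y t) /\ \sum_t y t *: generator t = z.

(** The position of a generator in a basis is used as a matrix index; t0 is only
    the value outside the range. *)
Definition elem S (j : nat) := nth t0 (enum S) j.

Definition generator_mx m S : 'M[R]_(m, n + r) := \matrix_(j < m) generator (elem S j).

Definition is_basis S :=
  (#|S| == n + r)%N && (generator_mx (n + r) S \in unitmx).

Definition coords S z := z *m invmx (generator_mx (n + r) S).

Definition cell S z := forall j, 0 <= coords S z ord0 j.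

Definition supp y : {set T} := [set t | y t != 0]%SET.

(** Nondegeneracy: no representation uses fewer generators than a basis has. *)
Definition generic z := forall y, nonneg_comb y z -> (n + r <= #|supp y|)%N.

Definition cost w S z := \sum_j coords S z ord0 j * w (elem S j).

(** The price of bringing t into the basis S: what t costs, minus what the
    elements of S that represent t cost. *)
Definition reduced_cost w S t := w t - cost w S (generator t).

(** Optimality involves no point: it is the certificate of linear programming
    duality, so that one basis serves all the points of its cell. *)
Definition optimal w S := is_basis S && [forall t, 0 <= reduced_cost w S t].

Lemma sum_elem (V : nmodType) S (F : T -> V) m : #|S| = m ->
  \sum_(t in S) F t = \sum_(j < m) F (elem S j).
Proof.
by move=> <-; rewrite -big_enum (big_nth t0) -cardE big_mkord.
Qed.

Lemma elem_in S m (j : 'I_m) : #|S| = m -> elem S j \in S.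
Proof. by move=> Sm; rewrite /elem -mem_enum mem_nth// -cardE Sm. Qed.

Lemma elem_inj S m (i j : 'I_m) : #|S| = m -> (elem S i == elem S j) = (i == j).
Proof.
by move=> Sm; rewrite /elem nth_uniq ?enum_uniq// -cardE Sm.
Qed.

Lemma elem_surj S m t : #|S| = m -> t \in S -> exists j : 'I_m, t = elem S j.
Proof.
move=> Sm tS; have tm : (index t (enum S) < m)%N.
  by rewrite -Sm cardE index_mem mem_enum.
by exists (Ordinal tm); rewrite /elem/= nth_index// mem_enum.
Qed.

Definition extend m S (u : 'rV[R]_m) t :=
  \sum_(j < m) u ord0 j * (elem S j == t)%:R.

Lemma extend_elem m S u (j : 'I_m) : #|S| = m -> extend S u (elem S j) = u ord0 j.
Proof.
move=> Sm; rewrite /extend (bigD1 j)//= eqxx mulr1 big1 ?addr0// => i ij.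
by rewrite (elem_inj _ _ Sm) (negbTE ij) mulr0.
Qed.

Lemma extend_out m S (u : 'rV[R]_m) t : #|S| = m -> t \notin S ->
  extend S u t = 0.
Proof.
move=> Sm tS; rewrite /extend big1// => i _; case: eqVneq => [E|]; last by rewrite mulr0.
by rewrite -E (elem_in _ Sm) in tS.
Qed.

Lemma sum_extend (V : lmodType R) m S (u : 'rV[R]_m) (F : T -> V) : #|S| = m ->
  \sum_t extend S u t *: F t = \sum_(j < m) u ord0 j *: F (elem S j).
Proof.
move=> Sm; rewrite (bigID (fun t => t \in S))/= [X in _ + X]big1 ?addr0; last first.
  by move=> t tS; rewrite (extend_out _ Sm)// scale0r.
by rewrite (sum_elem _ Sm); apply: eq_bigr => j _; rewrite extend_elem.
Qed.

Lemma sum_on_supp S y (V : lmodType R) (F : T -> V) m :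
  supp y \subset S -> #|S| = m ->
  \sum_t y t *: F t = \sum_(j < m) y (elem S j) *: F (elem S j).
Proof.
move=> yS Sm; rewrite (bigID (fun t => t \in S))/= [X in _ + X]big1 ?addr0 ?(sum_elem _ Sm)//.
move=> t tS; have -> : y t = 0; last by rewrite scale0r.
by apply: contraNeq tS => yt; apply: (fintype.subsetP yS); rewrite inE.
Qed.

Lemma mul_generator_mx m S (u : 'rV[R]_m) :
  u *m generator_mx m S = \sum_(j < m) u ord0 j *: generator (elem S j).
Proof.
rewrite mulmx_sum_row; apply: eq_bigr => j _; congr (_ *: _).
by apply/rowP => k; rewrite !mxE.
Qed.

Lemma sum_coords S z : is_basis S ->
  \sum_(j < n + r) coords S z ord0 j *: generator (elem S j) = z.
Proof. by move=> /andP[_ uS]; rewrite -mul_generator_mx mulmxKV. Qed.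

Lemma coords_on_supp S y z : is_basis S -> nonneg_comb y z ->
  supp y \subset S -> forall j, coords S z ord0 j = y (elem S j).
Proof.
move=> /andP[/eqP Sm uS] [_ <-] yS j.
pose u : 'rV[R]_(n + r) := \row_j y (elem S j).
rewrite (sum_on_supp _ yS Sm) (_ : \sum_(_ < _) _ = u *m generator_mx (n + r) S).
  by rewrite /coords mulmxK// mxE.
by rewrite mul_generator_mx; apply: eq_bigr => i _; rewrite mxE.
Qed.

Lemma cell_nonneg_comb S z : is_basis S -> cell S z ->
  nonneg_comb (extend S (coords S z)) z.
Proof.
move=> bS cS; have /andP[/eqP Sm uS] := bS; split => [t|].
  have [/(elem_surj Sm)[j ->]|tS] := boolP (t \in S); first by rewrite extend_elem.
  by rewrite (extend_out _ Sm).
by rewrite (sum_extend _ _ Sm) sum_coords.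
Qed.

(** Every generator has mass one in the last r coordinates, so a linear
    relation between generators has total mass zero. *)
Lemma relation_sum v : \sum_t v t *: generator t = 0 -> \sum_t v t = 0.
Proof.
move=> v0; pose one : 'cV[R]_r := const_mx 1.
transitivity ((rsubmx (\sum_t v t *: generator t) *m one) ord0 ord0); last first.
  by rewrite v0 linear0 mul0mx mxE.
rewrite linear_sum mulmx_suml summxE; apply: eq_bigr => t _.
rewrite linearZ/= row_mxKr -scalemxAl mxE -rowE mxE.
by rewrite mxE mulr1.
Qed.

Lemma relation_has_neg v : \sum_t v t *: generator t = 0 -> (exists t, v t != 0) ->
  exists t, v t < 0.
Proof.
move=> /relation_sum v0 [t vt].
apply/existsP; apply: contraNT vt => /existsPn v_ge0.
have v_ge0' s : true -> 0 <= v s by rewrite leNgt v_ge0.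
by move/eqP: v0; rewrite psumr_eq0// => /allP/(_ t (mem_index_enum t)).
Qed.

Lemma exists_relation S : (n + r <= #|S|)%N -> ~~ is_basis S ->
  exists v, [/\ \sum_t v t *: generator t = 0, exists t, v t != 0 & supp v \subset S].
Proof.
move=> NS nbS.
have [fS|] := boolP (row_free (generator_mx #|S| S)).
  have SN : #|S| = (n + r)%N.
    apply/eqP; rewrite eqn_leq NS andbT -[X in (X <= _)%N](eqP fS).
    exact: rank_leq_col.
  by move: nbS fS; rewrite /is_basis SN eqxx -row_free_unit /= => /negP.
rewrite -kermx_eq0 => /rowV0Pn[u /sub_kermxP uS u0].
exists (extend S u); split.
- by rewrite (sum_extend _ _ erefl) -mul_generator_mx.
- have [j uj] : exists j, u ord0 j != 0 by exact/rV0Pn.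
  by exists (elem S j); rewrite extend_elem.
- apply/fintype.subsetP => t; rewrite inE; apply: contraNT => tS.
  by rewrite (extend_out _ erefl).
Qed.

(** Sliding along a linear relation until a coefficient vanishes keeps the
    point, does not increase the cost when the direction is chosen well, and
    shrinks the support; genericity stops the process at a basis. *)
Lemma exists_cheaper_basis w z y : generic z -> nonneg_comb y z ->
  exists S, [/\ is_basis S, forall j, 0 < coords S z ord0 j &
               cost w S z <= \sum_t w t * y t].
Proof.
move=> gz; have [k] := ubnP #|supp y|; elim: k y => // k IH y yk yz.
have [bS|nbS] := boolP (is_basis (supp y)).
  have cy := coords_on_supp bS yz (subxx _).
  have /andP[/eqP Sm _] := bS; exists (supp y); split => // [j|].
    rewrite cy lt_def yz.1 andbT; have := elem_in j Sm; by rewrite inE.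
  rewrite /cost (eq_bigr (fun t => y t *: (w t : R^o))) => [|t _]; last exact: mulrC.
  rewrite (sum_on_supp _ (subxx _) Sm).
  by under eq_bigr do rewrite cy.
have [v [v0 vn0 vS]] := exists_relation (gz _ yz) nbS.
wlog wv : v v0 vn0 vS / \sum_t w t * v t <= 0.
  move=> wl; have [|/ltW wv] := leP (\sum_t w t * v t) 0; first exact: wl.
  apply: (wl (fun t => - v t)).
  - by under eq_bigr do rewrite scaleNr; rewrite sumrN v0 oppr0.
  - by have [t vt] := vn0; exists t; rewrite oppr_eq0.
  - apply: fintype.subset_trans vS; apply/fintype.subsetP => t; by rewrite !inE oppr_eq0.
  - by under eq_bigr do rewrite mulrN; rewrite sumrN oppr_le0.
have [s vs] := relation_has_neg v0 vn0.
(* the first coefficient to reach zero when moving in the direction v *)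
case: (@arg_minP _ R T s (fun t => v t < 0) (fun t => y t / - v t) vs) => t vt tmin.
pose tau := y t / - v t.
have yt : y t != 0.
  suff : t \in supp y by rewrite inE.
  by apply: (fintype.subsetP vS); rewrite inE lt_eqF.
have tau0 : 0 <= tau by rewrite divr_ge0 ?yz.1// oppr_ge0 ltW.
pose y' u := y u + tau * v u.
have y'z : nonneg_comb y' z.
  split=> [u|]; last first.
    under eq_bigr do rewrite scalerDl -scalerA.
    by rewrite big_split/= -scaler_sumr v0 scaler0 addr0 yz.2.
  rewrite /y'; have [vu|vu] := ltP (v u) 0; last by rewrite addr_ge0 ?yz.1// mulr_ge0.
  have := tmin u vu; rewrite ler_pdivlMr ?oppr_gt0//= mulrN.
  by rewrite -subr_ge0 opprK.
have y'sub : supp y' \proper supp y.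
  apply/properP; split.
    apply/fintype.subsetP => u; rewrite !inE /y'; apply: contra => /eqP yu.
    rewrite yu add0r mulf_eq0; apply/orP; right.
    apply: contraTT (introT eqP yu) => vu.
    suff : u \in supp y by rewrite inE.
    by apply: (fintype.subsetP vS); rewrite inE.
  exists t; rewrite !inE //= negbK /y' /tau invrN mulrN mulNr divfK ?subrr//.
  by rewrite lt_eqF.
have [|S [bS Sp Sc]] := IH y' _ y'z.
  by apply: leq_trans (proper_card y'sub) _; rewrite -ltnS.
exists S; split => //; apply: le_trans Sc _.
under eq_bigr do rewrite mulrDr mulrCA.
by rewrite big_split/= -mulr_sumr gerDl mulr_ge0_le0.
Qed.

(** Duality.  Replacing every generator by its expansion in the basis turns any
    representation of z into the one on the basis, and the difference of costs
    is accounted for by the reduced costs. *)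
Lemma cost_eq w S z y : is_basis S -> nonneg_comb y z ->
  \sum_t w t * y t = cost w S z + \sum_t reduced_cost w S t * y t.
Proof.
move=> bS [_ yz]; under [X in _ + X]eq_bigr do rewrite mulrBl.
rewrite sumrB addrCA; set c := (X in _ - X); rewrite (_ : cost w S z = c) ?subrr ?addr0//.
rewrite /c /cost; under [RHS]eq_bigr do rewrite mulr_suml.
rewrite exchange_big/=; apply: eq_bigr => j _.
rewrite -yz /coords mulmx_suml summxE mulr_suml; apply: eq_bigr => t _.
by rewrite -scalemxAl mxE -mulrA mulrC.
Qed.

Lemma reduced_cost_elem w S (j : 'I_(n + r)) : is_basis S ->
  reduced_cost w S (elem S j) = 0.
Proof.
move=> bS; have /andP[/eqP Sm _] := bS; apply/eqP; rewrite subr_eq0 eq_sym.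
pose y t : R := (t == elem S j)%:R.
have sy : supp y \subset S.
  apply/fintype.subsetP => t; rewrite inE /y pnatr_eq0 eqb0 negbK => /eqP ->.
  exact: elem_in Sm.
have yz : nonneg_comb y (generator (elem S j)).
  split=> [t|]; first exact: ler0n.
  rewrite (bigD1 (elem S j))//= /y eqxx scale1r big1 ?addr0// => t tj.
  by rewrite (negbTE tj) scale0r.
rewrite /cost; under eq_bigr do rewrite (coords_on_supp bS yz sy) /y (elem_inj _ _ Sm).
rewrite (bigD1 j)//= eqxx mul1r big1 ?addr0// => i ij.
by rewrite (negbTE ij) mul0r.
Qed.

(** The simplex method: a cheapest basis for z is optimal, for otherwise some
    generator with negative reduced cost can be brought in with a small positive
    coefficient, all the coordinates of z being positive by genericity. *)
Lemma optimal_cell_exists w z y : generic z -> nonneg_comb y z ->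
  exists2 S, optimal w S & cell S z.
Proof.
move=> gz yz; have [S0 [bS0 S0p _]] := exists_cheaper_basis w gz yz.
pose P S := is_basis S && [forall j, 0 < coords S z ord0 j].
have PS0 : P S0 by rewrite /P bS0; exact/forallP.
case: (@arg_minP _ R _ S0 P (fun S => cost w S z) PS0) => S /andP[bS /forallP Sp] Smin.
exists S; last by move=> j; exact/ltW/Sp.
rewrite /optimal bS/=; apply/forallP => t; rewrite leNgt; apply/negP => ct.
have /andP[/eqP Sm _] := bS.
pose c := coords S (generator t); pose zS := coords S z.
have subE (A B : 'rV[R]_(n + r)) e j :
  (A - e *: B) ord0 j = A ord0 j - e * B ord0 j by rewrite !mxE.
(* a step length that keeps all the coordinates of z nonnegative *)
pose eps := (1 + \sum_j `|c ord0 j| / zS ord0 j)^-1.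
have sum_ge0 : 0 <= \sum_j `|c ord0 j| / zS ord0 j.
  by apply: sumr_ge0 => j _; rewrite divr_ge0// ltW// Sp.
have eps0 : 0 < eps by rewrite invr_gt0 ltr_wpDr.
pose y' u := extend S (zS - eps *: c) u + eps * (u == t)%:R.
have y'z : nonneg_comb y' z.
  split=> [u|].
    apply: addr_ge0; last by rewrite mulr_ge0// ltW.
    have [/(elem_surj Sm)[j ->]|uS] := boolP (u \in S); last by rewrite (extend_out _ Sm).
    rewrite extend_elem// subE subr_ge0 (le_trans (ler_norm _))// normrM gtr0_norm//.
    rewrite mulrC ler_pdivrMr ?ltr_wpDr// mulrDr mulr1.
    rewrite (bigD1 j)//= mulrDr [X in _ + (X + _)]mulrCA mulfV ?gt_eqF ?Sp// mulr1.
    rewrite addrCA lerDl addr_ge0 ?(ltW (Sp j))// mulr_ge0 ?(ltW (Sp j))//.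
    by apply: sumr_ge0 => i _; rewrite divr_ge0// ltW// Sp.
  under eq_bigr do rewrite scalerDl.
  rewrite big_split/= (sum_extend _ _ Sm).
  rewrite [X in _ + X](bigD1 t)//= eqxx mulr1 [X in _ + (_ + X)]big1; last first.
    by move=> u ut; rewrite (negbTE ut) mulr0 scale0r.
  under eq_bigr do rewrite subE scalerBl -scalerA.
  by rewrite addr0 sumrB sum_coords// -scaler_sumr sum_coords// subrK.
have [S' [bS' S'p S'c]] := exists_cheaper_basis w gz y'z.
have PS' : P S' by rewrite /P bS'; exact/forallP.
have /(le_trans (Smin _ PS')) := S'c.
rewrite (cost_eq w bS y'z) lerDl leNgt => /negP; apply.
rewrite (eq_bigr (fun u => extend S (zS - eps *: c) u *: (reduced_cost w S u : R^o) +
   eps * (u == t)%:R * reduced_cost w S u)) => [|u _].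
  rewrite big_split/= (sum_extend _ _ Sm) big1 ?add0r => [|j _].
    rewrite (bigD1 t)//= eqxx mulr1 big1 ?addr0 ?pmulr_rlt0// => u ut.
    by rewrite (negbTE ut) mulr0 mul0r.
  by rewrite reduced_cost_elem// scaler0.
by rewrite [LHS]mulrC mulrDl.
Qed.

Definition generic_weight w :=
  forall S t, is_basis S -> t \notin S -> reduced_cost w S t != 0.

(** Name the bases so that the second is no dearer.  By [cost_eq] its
    representation of z puts weight only on generators of reduced cost zero for
    the first basis, and generic weights leave only its own elements. *)
Lemma optimal_cell_unique w z S1 S2 : generic_weight w -> generic z ->
  optimal w S1 -> optimal w S2 -> cell S1 z -> cell S2 z -> S1 = S2.
Proof.
move=> gw gz; wlog : S1 S2 / cost w S2 z <= cost w S1 z.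
  move=> wl o1 o2 c1 c2; have [|/ltW] := leP (cost w S2 z) (cost w S1 z).
    by move/wl; exact.
  by move/wl => /(_ o2 o1 c2 c1).
move=> c12 /andP[b1 /forallP r1] /andP[b2 _] c1 c2.
have /andP[/eqP m1 _] := b1; have /andP[/eqP m2 _] := b2.
have yz := cell_nonneg_comb b2 c2; set y := extend _ _ in yz.
have y2 : supp y \subset S2.
  apply/fintype.subsetP => t; rewrite inE; apply: contraNT => tS.
  by rewrite /y (extend_out _ m2).
have suppy : supp y = S2.
  by apply/eqP; rewrite eqEcard y2 m2; exact: gz.
have yE : \sum_t w t * y t = cost w S2 z.
  rewrite (eq_bigr (fun t => y t *: (w t : R^o))) => [|t _]; last exact: mulrC.
  by rewrite (sum_extend _ _ m2).
have ry_ge0 t : true -> 0 <= reduced_cost w S1 t * y t.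
  by move=> _; rewrite mulr_ge0//; exact: yz.1.
have : \sum_t reduced_cost w S1 t * y t <= 0.
  by rewrite -(lerD2l (cost w S1 z)) -(cost_eq w b1 yz) yE addr0.
rewrite le_eqVlt ltNge sumr_ge0// orbF psumr_eq0// => /allP r0.
apply/esym/eqP; rewrite eqEcard m1 m2 leqnn andbT.
apply/fintype.subsetP => t; rewrite -suppy inE => yt.
have := r0 t (mem_index_enum t); rewrite /= mulf_eq0 (negbTE yt) orbF.
exact: contraTT (gw _ _ b1).
Qed.

(** Take the successive powers of a real number that avoids the finitely many
    roots of the polynomials expressing that a reduced cost vanishes. *)
Lemma exists_generic_weight : exists w, generic_weight w.
Proof.
pose num t : nat := enum_rank t.
pose p (St : {set T} * T) : {poly R} :=
  'X^(num St.2) - \sum_j (coords St.1 (generator St.2) ord0 j)%:P * 'X^(num (elem St.1 j)).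
pose q := \prod_(St : {set T} * T | is_basis St.1 && (St.2 \notin St.1)) p St.
have q0 : q != 0.
  rewrite prodf_seq_neq0; apply/allP => -[S t] _ /=; apply/implyP => /andP[bS tS].
  have /andP[/eqP Sm _] := bS.
  suff : (p (S, t))`_(num t) != 0 by apply: contraNneq => ->; rewrite coef0.
  rewrite coefB coefXn eqxx coef_sum big1 ?subr0 ?oner_eq0// => j _.
  rewrite coefCM coefXn; case: eqVneq => [/eqP|]; last by rewrite mulr0.
  rewrite (inj_eq val_inj) (inj_eq enum_rank_inj) => /eqP tj.
  by rewrite tj (elem_in _ Sm) in tS.
have [x qx] : exists x, ~~ root q x.
  pose s : seq R := [seq i%:R | i <- iota 0 (size q)].
  have us : uniq s.
    by rewrite map_inj_uniq ?iota_uniq// => i j /eqP; rewrite eqr_nat => /eqP.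
  have [/(max_poly_roots q0)/(_ us)|/allPn[x _ qx]] := boolP (all (root q) s).
    by rewrite size_map size_iota ltnn.
  by exists x.
exists (fun t => x ^+ num t) => S t bS tS.
move: qx; rewrite /root horner_prod prodf_seq_neq0 => /allP/(_ (S, t)).
rewrite mem_index_enum => /(_ isT)/implyP/=; rewrite bS tS => /(_ isT).
rewrite hornerD hornerN horner_sum hornerXn /reduced_cost /cost.
by under eq_bigr do rewrite hornerM hornerC hornerXn.
Qed.
End cells.

(** * Integrals over cells *)

Section tame.
Context {R : realType} {n : nat}.
Implicit Types (g : 'rV[R]_n -> R) (D : set 'rV[R]_n).

Definition box (rho : R) : set 'rV[R]_n :=
  [set v | forall i, `|v ord0 i| <= rho].

(** Measurable and bounded on bounded sets: what makes a polynomial function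
    integrable over a bounded set, in a form stable under composition. *)
Definition tame g := measurable_fun setT g /\
  forall rho, exists C, forall v, box rho v -> `|g v| <= C.

Lemma tame_cst c : tame (fun=> c).
Proof. by split => // rho; exists `|c|. Qed.

Lemma tame_coord i : tame (fun v => v ord0 i).
Proof.
by split=> [|rho]; [exact: measurable_coord_rV|exists rho => v; exact].
Qed.

Lemma tameD g1 g2 : tame g1 -> tame g2 -> tame (fun v => g1 v + g2 v).
Proof.
move=> [m1 b1] [m2 b2]; split; first exact: measurable_funD.
move=> rho; have [C1 h1] := b1 rho; have [C2 h2] := b2 rho.
exists (C1 + C2) => v bv; rewrite (le_trans (ler_normD _ _))//.
by rewrite lerD ?h1 ?h2.
Qed.

Lemma tameM g1 g2 : tame g1 -> tame g2 -> tame (fun v => g1 v * g2 v).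
Proof.
move=> [m1 b1] [m2 b2]; split; first exact: measurable_funM.
move=> rho; have [C1 h1] := b1 rho; have [C2 h2] := b2 rho.
exists (C1 * C2) => v bv.
by rewrite normrM ler_pM ?h1 ?h2.
Qed.

Lemma tame_norm g : tame g -> tame (Num.norm \o g).
Proof.
move=> [mg bg]; split; first exact: measurableT_comp.
by move=> rho; have [C hC] := bg rho; exists C => v /hC; rewrite /= normr_id.
Qed.

Lemma tame_big (op : R -> R -> R) idx (I : Type) (s : seq I)
    (g : I -> 'rV[R]_n -> R) :
  (forall g1 g2, tame g1 -> tame g2 -> tame (fun v => op (g1 v) (g2 v))) ->
  (forall i, tame (g i)) -> tame (fun v => \big[op/idx]_(i <- s) g i v).
Proof.
move=> hop hg; elim: s => [|i s IH].
  by under eq_fun do rewrite big_nil; exact: tame_cst.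
by under eq_fun do rewrite big_cons; exact: hop.
Qed.

Lemma measurable_box_radius rho : measurable (box rho).
Proof.
rewrite (_ : box rho = [set v | forall i, [set x | `|x| <= rho] (v ord0 i)])//.
apply: (@measurable_box R n (fun=> [set x | `|x| <= rho])) => _.
rewrite (_ : mkset _ = `[- rho, rho]%classic); first exact: measurable_itv.
by apply/seteqP; split => x /=; rewrite in_itv/= ler_norml.
Qed.

Lemma lebesgue_rV_box_lty rho : (lebesgue_rV n (box rho) < +oo)%E.
Proof.
have E : [set x : R | `|x| <= rho] = `[- rho, rho]%classic.
  by apply/seteqP; split => x /=; rewrite in_itv/= ler_norml.
rewrite (_ : box rho = [set v | forall i, [set x | `|x| <= rho] (v ord0 i)])//.
rewrite (lebesgue_rV_box (A := fun=> [set x | `|x| <= rho])); last first.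
  by move=> _; rewrite E; exact: measurable_itv.
rewrite (eq_bigr (fun=> lebesgue_measure `[- rho, rho]%classic)); last first.
  by move=> i _; rewrite E.
rewrite lebesgue_measure_itv/=; case: ifP => _.
  by rewrite -EFinB prodEFin ltry.
by rewrite (eq_bigr (fun=> (0:R)%:E))// prodEFin ltry.
Qed.

Lemma integrable_tame g D rho : tame g -> measurable D -> D `<=` box rho ->
  (lebesgue_rV n).-integrable D (EFin \o g).
Proof.
move=> [mg bg] mD Dbox; have [C hC] := bg rho.
apply: measurable_bounded_integrable => //.
- apply: le_lt_trans (lebesgue_rV_box_lty rho); apply: le_measure => //.
  + by rewrite inE.
  + by rewrite inE; exact: measurable_box_radius.
- exact: measurable_funTS.
exists C; split; first exact: num_real.
by move=> M /ltW CM v Dv /=; rewrite (le_trans (hC v _))//; exact: Dbox.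
Qed.

End tame.

Lemma tame_comp {R : realType} n m (phi : 'rV[R]_n -> 'rV[R]_m)
    (g : 'rV[R]_m -> R) :
  (forall i, tame (fun x => phi x ord0 i)) -> tame g -> tame (fun x => g (phi x)).
Proof.
move=> tphi [mg bg]; split.
  by apply: measurableT_comp => //; apply: measurable_fun_rV => i; case: (tphi i).
move=> rho; have [C hC] := choice (fun i => (tphi i).2 rho).
have [D hD] := bg (\sum_i `|C i|); exists D => x bx; apply: hD => i.
rewrite (le_trans (hC i x bx))// (le_trans (ler_norm _))//.
by rewrite (bigD1 i)//= lerDl sumr_ge0.
Qed.

Section cell_integrals.
Context {R : realType} {n r : nat} {T : finType} (t0 : T).
Context (a : T -> 'rV[R]_n) (beta : T -> 'I_r).
Implicit Types (S : {set T}) (lam : 'I_r -> R) (x : 'rV[R]_n) (y : T -> R).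

Local Notation generator := (generator a beta).
Local Notation elem := (elem t0).
Local Notation basis := (is_basis t0 a beta).
Local Notation nonneg_comb := (nonneg_comb a beta).
Local Notation basis_mx S := (generator_mx t0 a beta (n + r) S).

Definition lift_pt x lam : 'rV[R]_(n + r) := row_mx x (\row_i lam i).

Lemma nonneg_combP y x lam : nonneg_comb y (lift_pt x lam) <->
  [/\ forall t, 0 <= y t, \sum_t y t *: a t = x &
      forall i, \sum_(t | beta t == i) y t = lam i].
Proof.
have combE : \sum_t y t *: generator t =
    row_mx (\sum_t y t *: a t) (\row_i \sum_(t | beta t == i) y t).
  rewrite (eq_bigr (fun t => row_mx (y t *: a t) (y t *: delta_mx ord0 (beta t)))).
    rewrite -[LHS]hsubmxK !linear_sum/=; congr row_mx.
      by apply: eq_bigr => t _; rewrite row_mxKl.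
    apply/rowP => i; rewrite summxE mxE [RHS]big_mkcond/=; apply: eq_bigr => t _.
    by rewrite row_mxKr !mxE eqxx/= eq_sym; case: eqP; rewrite ?mulr1 ?mulr0.
  by move=> t _; rewrite scale_row_mx.
rewrite /nonneg_comb combE /lift_pt; split=> [[y0 /eq_row_mx[-> E]]|[y0 -> E]].
  by split => // i; have /rowP/(_ i) := E; rewrite !mxE.
by split => //; congr row_mx; apply/rowP => i; rewrite !mxE.
Qed.

(** A set of fewer than n + r generators spans a proper subspace, so it lies
    in a hyperplane; when every block is represented, that hyperplane does not
    contain the slice at lam, because a functional that ignores the first n
    coordinates and kills a generator of each block is zero. *)
Lemma ae_generic lam : positive lam ->
  {ae lebesgue_rV n, forall x, generic a beta (lift_pt x lam)}.
Proof.
move=> lam0.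
pose bad (A : {set T}) x := exists y, nonneg_comb y (lift_pt x lam) /\ supp y = A.
suff : {ae lebesgue_rV n, forall x, forall A : {set T},
    (#|A| < n + r)%N -> ~ bad A x}.
  apply: filterS => x nbad y yx; rewrite leqNgt; apply/negP => /nbad; apply.
  by exists y.
apply: filter_forall => A.
have [nA|nA] := leqP (n + r) #|A|.
  exact: nearW.
have [p p0 Ap] : exists2 p : 'cV[R]_(n + r), p != 0 &
    forall t, t \in A -> generator t *m p = 0.
  have : ~~ row_free (generator_mx t0 a beta #|A| A)^T.
    rewrite /row_free mxrank_tr neq_ltn (leq_ltn_trans (rank_leq_row _))//.
  rewrite -kermx_eq0 => /rowV0Pn[u /sub_kermxP uA u0].
  exists u^T; first by rewrite trmx_eq0.
  move=> t /(elem_surj t0 erefl)[j ->].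
  rewrite (_ : generator _ = row j (generator_mx t0 a beta #|A| A)); last first.
    by apply/rowP => k; rewrite !mxE.
  rewrite -row_mul (_ : _ *m _ = 0) ?row0//.
  by apply: trmx_inj; rewrite trmx_mul trmxK uA trmx0.
have [bA|bA] := boolP [forall i, [exists t in A, beta t == i]]; last first.
  apply: nearW => x _ [y [/nonneg_combP[y0 _ yl] yA]].
  move: bA; rewrite negb_forall => /existsP[i /existsPn iA].
  have := lam0 i; rewrite -yl big1 ?ltxx// => t ti.
  apply/eqP; have := iA t; rewrite ti andbT; apply: contraNT => yt.
  by rewrite -yA inE.
have up0 : usubmx p != 0.
  apply: contraNneq p0 => up0; rewrite -[p]vsubmxK up0.
  suff -> : dsubmx p = 0 by rewrite col_mx0.
  apply/colP => i; have /existsP[t /andP[tA /eqP ti]] := forallP bA i.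
  have /matrixP/(_ ord0 ord0) := Ap t tA.
  rewrite -{1}[p]vsubmxK up0 mul_row_col mulmx0 add0r ti -rowE !mxE => <-.
  by congr (p _ _).
exists [set x | (x *m usubmx p) ord0 ord0 + ((\row_i lam i) *m dsubmx p) ord0 ord0 = 0].
split.
- exact: measurable_hyperplane.
- exact: lebesgue_rV_hyperplane.
move=> x /= /not_implyP[_ /contrapT[y [[y0 yx] yA]]].
have : lift_pt x lam *m p = 0.
  rewrite -yx mulmx_suml big1// => t _; rewrite -scalemxAl.
  have [/Ap ->|tA] := boolP (t \in A); first by rewrite scaler0.
  have -> : y t = 0 by apply/eqP; apply: contraNT tA; rewrite -yA inE.
  by rewrite scale0r.
move=> /matrixP/(_ ord0 ord0); rewrite -{1}[p]vsubmxK mul_row_col mxE => ->.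
by rewrite mxE.
Qed.

Lemma nonneg_comb_bounded y x lam : nonneg_comb y (lift_pt x lam) ->
  box ((\sum_i lam i) * \sum_t \sum_i `|a t ord0 i|) x.
Proof.
move=> /nonneg_combP[y0 <- yl] i; rewrite summxE mulr_sumr.
apply: le_trans (ler_norm_sum _ _ _) _; apply: ler_sum => t _.
rewrite mxE normrM ger0_norm//; apply: ler_pM => //.
  under eq_bigr do rewrite -yl.
  rewrite (bigD1 (beta t))//= (bigD1 t)//= -addrA lerDl.
  by rewrite addr_ge0// ?sumr_ge0// => i' _; rewrite sumr_ge0.
by rewrite (bigD1 i)//= lerDl sumr_ge0.
Qed.

Lemma coords_lift S x lam : coords t0 a beta S (lift_pt x lam) =
  x *m usubmx (invmx (basis_mx S)) + \row_i lam i *m dsubmx (invmx (basis_mx S)).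
Proof. by rewrite /coords /lift_pt -{1}[invmx _]vsubmxK mul_row_col. Qed.

Definition slice S lam : set 'rV[R]_n := [set x | cell t0 a beta S (lift_pt x lam)].

Lemma measurable_slice S lam : measurable (slice S lam).
Proof.
rewrite (_ : slice S lam = \bigcap_(j in [set: 'I_(n + r)])
    (fun x => coords t0 a beta S (lift_pt x lam)) @^-1` [set v | 0 <= v ord0 j]); last first.
  apply/seteqP; split => x /= cx; first by move=> j _; exact: cx.
  by move=> j; exact: cx.
apply: fin_bigcap_measurable => // j _.
have mpos : measurable [set v : 'rV[R]_(n + r) | 0 <= v ord0 j].
  rewrite (_ : mkset _ = (fun v : 'rV[R]_(n + r) => v ord0 j) @^-1` `[0, +oo[).
    rewrite -[X in measurable X]setTI.
    by apply: measurable_coord_rV => //; exact: measurable_itv.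
  by apply/seteqP; split => v /=; rewrite in_itv/= andbT.
under [X in X @^-1` _]eq_fun do rewrite coords_lift.
by rewrite -[X in measurable X]setTI; exact: measurable_affine_rV.
Qed.

Lemma slice_bounded S lam : basis S ->
  exists rho, slice S lam `<=` box rho.
Proof.
by move=> bS; eexists => x /(cell_nonneg_comb bS)/nonneg_comb_bounded; exact.
Qed.

(** The linear map that multiplies the coordinate of each generator of the
    basis by the parameter of its block. *)
Definition dilation S lam : 'M[R]_(n + r) :=
  invmx (basis_mx S) *m diag_mx (\row_j lam (beta (elem S j))) *m basis_mx S.

Lemma mulmx_rsubmx m (A : 'M[R]_(m, n + r)) (B : 'M[R]_(n + r)) :
  rsubmx (A *m B) = A *m rsubmx B.
Proof. by rewrite -{1}[B]hsubmxK mul_mx_row row_mxKr. Qed.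

(** The block masses of a point are its last r coordinates, so the dilation
    acts on them diagonally and does not feed them from the first n. *)
Lemma dilation_block S lam : basis S ->
  dilation S lam = block_mx (ulsubmx (dilation S lam)) 0
                            (dlsubmx (dilation S lam)) (diag_mx (\row_i lam i)).
Proof.
move=> /andP[_ uS].
suff right_cols : rsubmx (dilation S lam) = col_mx 0 (diag_mx (\row_i lam i)).
  rewrite -[LHS]hsubmxK right_cols block_mxEh; congr row_mx.
  by rewrite -[LHS]vsubmxK; congr col_mx; apply/matrixP => i j; rewrite !mxE.
rewrite mulmx_rsubmx.
have swap : diag_mx (\row_j lam (beta (elem S j))) *m rsubmx (basis_mx S) =
    rsubmx (basis_mx S) *m diag_mx (\row_i lam i).
  have BrE j i : rsubmx (basis_mx S) j i = (i == beta (elem S j))%:R.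
    by rewrite mxE mxE row_mxEr mxE.
  apply/matrixP => j i; rewrite mul_diag_mx mul_mx_diag mxE [RHS]mxE BrE !mxE.
  by have [->|_] := eqVneq; rewrite ?mulr1 ?mul1r// mulr0 mul0r.
rewrite -mulmxA swap mulmxA -mulmx_rsubmx mulVmx//.
rewrite (_ : rsubmx 1%:M = col_mx 0 1%:M); last first.
  by rewrite scalar_mx_block block_mxEh row_mxKr.
by rewrite mul_col_mx mul0mx mul1mx.
Qed.

Lemma det_dilation S lam : basis S -> positive lam ->
  0 < \det (ulsubmx (dilation S lam)).
Proof.
move=> bS lam0; have /andP[_ uS] := bS.
have E : \det (dilation S lam) = \prod_(j < n + r) lam (beta (elem S j)).
  rewrite !det_mulmx det_diag det_inv mulrAC mulVf ?mul1r; last by rewrite -unitfE -unitmxE.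
  by apply: eq_bigr => j _; rewrite mxE.
have det_lam : \det (diag_mx (\row_i lam i)) = \prod_i lam i.
  by rewrite det_diag; apply: eq_bigr => i _; rewrite mxE.
rewrite (dilation_block lam bS) det_lblock det_lam in E.
have pl : 0 < \prod_i lam i by apply: prodr_gt0.
by rewrite -(pmulr_lgt0 _ pl) E; apply: prodr_gt0 => j _.
Qed.

Definition unit_param : 'I_r -> R := fun=> 1.

Definition shift_vec S lam := (\row_i unit_param i) *m dlsubmx (dilation S lam).

Lemma lift_dilation S x lam : basis S ->
  lift_pt x unit_param *m dilation S lam =
  lift_pt (x *m ulsubmx (dilation S lam) + shift_vec S lam) lam.
Proof.
move=> bS; rewrite [X in _ *m X](dilation_block lam bS) /lift_pt mul_row_block.
rewrite mulmx0 add0r; congr row_mx.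
by apply/rowP => i; rewrite mul_mx_diag !mxE mul1r.
Qed.

Lemma slice_dilation S lam : basis S -> positive lam ->
  [set x | slice S lam (x *m ulsubmx (dilation S lam) + shift_vec S lam)] =
  slice S unit_param.
Proof.
move=> bS lam0; have /andP[_ uS] := bS.
have cE x j : coords t0 a beta S
    (lift_pt (x *m ulsubmx (dilation S lam) + shift_vec S lam) lam) ord0 j =
    coords t0 a beta S (lift_pt x unit_param) ord0 j * lam (beta (elem S j)).
  rewrite -lift_dilation// /coords /dilation !mulmxA mulmxK// mul_mx_diag mxE.
  by rewrite [X in _ * X = _]mxE.
apply/seteqP; split => x /= cx j; have := cx j; rewrite cE.
  by rewrite pmulr_lge0.
by rewrite pmulr_lge0.
Qed.

(** The change of variables by the dilation moves all the dependence on lam from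
    the domain to the integrand, where it is polynomial: degree d from Q and
    degree n from the determinant of an n by n matrix that is linear in lam. *)
Lemma hpoly_slice S d (Q : 'rV[R]_n -> R) : basis S -> tame Q ->
  (forall phi : ('I_r -> R) -> 'rV[R]_n,
     (forall i, hpoly 1 (fun lam => phi lam ord0 i)) ->
     hpoly d (fun lam => Q (phi lam))) ->
  hpoly (d + n) (fun lam => \int[lebesgue_rV n]_(x in slice S lam) Q x).
Proof.
move=> bS tQ hQ; pose phi x lam := x *m ulsubmx (dilation S lam) + shift_vec S lam.
have hdil i j : hpoly 1 (fun lam => dilation S lam i j).
  apply: (@eq_hpoly _ _ _ (fun lam => \sum_k
    (invmx (basis_mx S) i k * basis_mx S k j) * lam (beta (elem S k)))).
    move=> lam _; rewrite [RHS]mxE; apply: eq_bigr => k _.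
    by rewrite mul_mx_diag !mxE mulrAC.
  by apply: hpoly_sum => k _; apply: hpolyZ; exact: hpoly_coord.
have hphi x i : hpoly 1 (fun lam => phi x lam ord0 i).
  apply: (@eq_hpoly _ _ _ (fun lam =>
    (\sum_k x ord0 k * dilation S lam (lshift r k) (lshift r i)) +
    \sum_k 1 * dilation S lam (rshift n k) (lshift r i))).
    move=> lam _; rewrite /phi /shift_vec !mxE; congr (_ + _).
      by apply: eq_bigr => k _; rewrite !mxE.
    by apply: eq_bigr => k _; rewrite !mxE.
  by apply: hpolyD; apply: hpoly_sum => k _; exact: hpolyZ.
have [rho Srho] := slice_bounded unit_param bS.
have tphi lam i : tame (fun x => phi x lam ord0 i).
  rewrite (_ : (fun _ => _) = fun x : 'rV[R]_n => \sum_k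
    x ord0 k * ulsubmx (dilation S lam) k i + shift_vec S lam ord0 i); last first.
    by apply/funext => x; rewrite /phi mxE [X in X + _]mxE.
  apply: tameD; last exact: tame_cst.
  apply: tame_big => [|k]; first exact: tameD.
  by apply: tameM; [exact: tame_coord|exact: tame_cst].
apply: (@eq_hpoly _ _ _ (fun lam => (\int[lebesgue_rV n]_(x in slice S unit_param)
   Q (phi x lam)) * \det (ulsubmx (dilation S lam)))).
  move=> lam lam0; rewrite mulrC.
  rewrite -[X in X * _]gtr0_norm ?det_dilation// -(slice_dilation bS lam0).
  rewrite -Rintegral_substitution//.
  - by rewrite unitmxE unitfE gt_eqF// det_dilation.
  - exact: measurable_slice.
  - by case: tQ.
  - rewrite slice_dilation//; apply: (integrable_tame _ _ Srho).
      exact: (tame_comp (tphi lam)).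
    exact: measurable_slice.
rewrite -[n in (d + n)%N]muln1; apply: hpolyM; last first.
  apply: hpoly_det => i j; apply: eq_hpoly (hdil (lshift r i) (lshift r j)) => lam _.
  by rewrite !mxE.
apply: hpoly_Rintegral => [|x _|lam _].
- exact: measurable_slice.
- exact: hQ.
- apply: (integrable_tame _ _ Srho); last exact: measurable_slice.
  exact: (tame_comp (tphi lam)).
Qed.
End cell_integrals.

(** * Outer approximation by polytopes *)

Section polytopes.
Context {R : realType} {n r : nat} {T : finType} (t0 : T).
Context (a : T -> 'rV[R]_n) (beta : T -> 'I_r).

Definition in_polytope lam : set 'rV[R]_n :=
  [set x | exists y, nonneg_comb a beta y (lift_pt x lam)].

(** The integrand is stated to agree with Q on the polytope only almost
    everywhere, because the cells may overlap, and may fail to cover, at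
    degenerate points. *)
Lemma hpoly_polytope d (Q : 'rV[R]_n -> R) : tame Q ->
  (forall phi : ('I_r -> R) -> 'rV[R]_n,
     (forall i, hpoly 1 (fun lam => phi lam ord0 i)) ->
     hpoly d (fun lam => Q (phi lam))) ->
  exists f : ('I_r -> R) -> 'rV[R]_n -> R,
  [/\ hpoly (d + n) (fun lam => \int[lebesgue_rV n]_x f lam x),
      forall lam, measurable_fun setT (f lam) &
      forall lam, positive lam ->
        {ae lebesgue_rV n, forall x, f lam x = (Q \_ (in_polytope lam)) x}].
Proof.
move=> tQ hQ; have [w gw] := exists_generic_weight t0 a beta.
pose opt := [seq S <- index_enum {set T} | optimal t0 a beta w S].
pose sl S lam := slice t0 a beta S lam.
have basis_opt S : S \in opt -> is_basis t0 a beta S.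
  by rewrite mem_filter => /andP[/andP[]].
have msl S lam : measurable (sl S lam) by exact: measurable_slice.
have intS S lam : S \in opt -> (lebesgue_rV n).-integrable setT
    (EFin \o (Q \_ (sl S lam))).
  move=> /basis_opt bS; have [rho Srho] := slice_bounded lam bS.
  have /(integrable_mkcond _ (msl S lam)) := integrable_tame tQ (msl S lam) Srho.
  by rewrite -restrict_EFin.
exists (fun lam x => \sum_(S <- opt) (Q \_ (sl S lam)) x); split.
- apply: (@eq_hpoly _ _ _ (fun lam => \sum_(S <- opt)
      \int[lebesgue_rV n]_(x in sl S lam) Q x)) => [lam _|].
    rewrite (Rintegral_sum measurableT (fun S => intS S lam)).2.
    by apply: eq_bigr => S _; rewrite Rintegral_mkcond.
  under eq_fun do rewrite big_seq.
  by apply: hpoly_sum => S /basis_opt bS; exact: (hpoly_slice bS tQ hQ).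
- move=> lam; apply: measurable_sum => S.
  by apply/(measurable_restrictT _ (msl S lam)); apply: measurable_funTS; case: tQ.
- move=> lam lam0; apply: filterS (ae_generic t0 a beta lam0) => x gx.
  rewrite {2}/patch; case: ifPn => [/set_mem[y yx]|/negP nx].
    have [S oS cS] := optimal_cell_exists t0 w gx yx.
    have Sopt : S \in opt by rewrite mem_filter oS mem_index_enum.
    rewrite (bigD1_seq S)//=; last by rewrite filter_uniq ?index_enum_uniq.
    rewrite {1}/patch mem_set// big1_seq ?addr0// => S' /andP[S'S].
    rewrite mem_filter => /andP[oS' _]; rewrite /patch; case: ifPn => // /set_mem cS'.
    by rewrite (optimal_cell_unique gw gx oS oS' cS cS') eqxx in S'S.
  rewrite big1_seq// => S /andP[_ Sopt]; rewrite /patch; case: ifPn => // /set_mem cS.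
  exfalso; apply: nx; apply/mem_set; eexists.
  exact: (cell_nonneg_comb (basis_opt _ Sopt) cS).
Qed.
End polytopes.

Section outer_approximation.
Context {R : realType} {n r : nat}.
Implicit Types (A : set 'rV[R]_n) (lam : 'I_r -> R).

Definition thicken A (e : R) : set 'rV[R]_n :=
  [set x | exists2 u, A u & forall j, `|x ord0 j - u ord0 j| <= e].

Lemma closed_thicken A x : closed A -> ~ A x -> exists2 e, 0 < e & ~ thicken A e x.
Proof.
move=> cA Ax; have : nbhs x (~` A) by apply: open_nbhs_nbhs; split => //; exact: closed_openC.
move=> /nbhs_ballP[e /= e0 eA]; exists (e / 2); first by rewrite divr_gt0.
move=> [u Au xu]; apply: (eA u) => //; split => // i j; rewrite (ord1 i) /ball/=.
by rewrite (le_lt_trans (xu j))// ltr_pdivrMr// ltr_pMr// ltr1n.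
Qed.

(** Polytopes between K and its small neighbourhoods converge to K pointwise,
    K being closed, and stay in a fixed box, so dominated convergence applies. *)
Lemma hpoly_outer_approximation (K : ('I_r -> R) -> set 'rV[R]_n) d
    (Q : 'rV[R]_n -> R) : tame Q ->
  (forall phi : ('I_r -> R) -> 'rV[R]_n,
     (forall i, hpoly 1 (fun lam => phi lam ord0 i)) ->
     hpoly d (fun lam => Q (phi lam))) ->
  (forall lam, positive lam ->
    [/\ measurable (K lam), closed (K lam) & exists rho, K lam `<=` box rho]) ->
  (forall e : R, 0 < e -> exists (T : finType) (t0 : T) (a : T -> 'rV[R]_n) (beta : T -> 'I_r),
    forall lam, positive lam -> K lam `<=` in_polytope a beta lam /\
      in_polytope a beta lam `<=` thicken (K lam) (e * \sum_i lam i)) ->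
  hpoly (d + n) (fun lam => \int[lebesgue_rV n]_(x in K lam) Q x).
Proof.
move=> tQ hQ hK hP.
pose e_ k : R := k.+1%:R^-1.
have e_gt0 k : 0 < e_ k by rewrite invr_gt0.
have e_le1 k : e_ k <= 1 by rewrite invf_le1 ?ler1n.
have ex_f k : exists f : ('I_r -> R) -> 'rV[R]_n -> R,
  [/\ hpoly (d + n) (fun lam => \int[lebesgue_rV n]_x f lam x),
      forall lam, measurable_fun setT (f lam) &
      forall lam, positive lam -> exists P, [/\ K lam `<=` P,
        P `<=` thicken (K lam) (e_ k * \sum_i lam i) &
        {ae lebesgue_rV n, forall x, f lam x = (Q \_ P) x}]].
  have [T [t0 [a [beta hT]]]] := hP _ (e_gt0 k).
  have [f [hf mf fE]] := hpoly_polytope t0 a beta tQ hQ.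
  exists f; split => // lam lam0; exists (in_polytope a beta lam).
  by have [? ?] := hT lam lam0; split => //; exact: fE.
have [f hf] := choice ex_f.
apply: (@hpoly_cvg _ _ _ (fun k lam => \int[lebesgue_rV n]_x f k lam x)).
  by move=> k; have [] := hf k.
move=> lam lam0; have [mK cK [rho Krho]] := hK lam lam0.
have /choice[P hPk] : forall k, exists P, [/\ K lam `<=` P,
        P `<=` thicken (K lam) (e_ k * \sum_i lam i) &
        {ae lebesgue_rV n, forall x, f k lam x = (Q \_ P) x}].
  by move=> k; have [_ _ /(_ lam lam0)] := hf k.
have sum_ge0 : 0 <= \sum_i lam i by apply: sumr_ge0 => i _; exact/ltW/lam0.
pose rho' := rho + \sum_i lam i.
have Pbox k : P k `<=` box rho'.
  have [_ Pth _] := hPk k; move=> x /Pth[u /Krho urho xu] j.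
  rewrite -[x ord0 j](subrK (u ord0 j)) (le_trans (ler_normD _ _))// addrC lerD//.
  by rewrite (le_trans (xu j))// ler_piMl.
have Plim x : ~ K lam x -> \forall k \near \oo, ~ P k x.
  move=> Kx; have [eps eps0 epsx] := closed_thicken cK Kx.
  have : e_ k * (\sum_i lam i) @[k --> \oo] --> 0 * \sum_i lam i.
    by apply: cvgMr_tmp; exact: cvg_harmonic.
  rewrite mul0r => /cvgrPdist_le/(_ eps eps0); apply: filterS => k.
  rewrite sub0r normrN ger0_norm; last by rewrite mulr_ge0// ltW.
  move=> ek Pkx; apply: epsx; have [_ Pth _] := hPk k.
  have [u Ku xu] := Pth _ Pkx; exists u => // j; exact: le_trans (xu j) ek.
pose g x := (Num.norm \o Q) \_ (box rho') x.
have ae_all : {ae lebesgue_rV n, forall x, forall k, f k lam x = (Q \_ (P k)) x}.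
  by apply: ae_foralln => k; have [] := hPk k.
have [] := @dominated_convergence _ _ R (lebesgue_rV n) setT measurableT
  (fun k x => (f k lam x)%:E) (fun x => ((Q \_ (K lam)) x)%:E) (fun x => (g x)%:E).
- by move=> k; apply/measurable_EFinP; have [_ + _] := hf k; exact.
- apply/measurable_EFinP/(measurable_restrictT _ mK); apply: measurable_funTS.
  by case: tQ.
- apply: filterS ae_all => x fE _; under eq_fun do rewrite fE.
  apply: cvg_EFin; first by apply: nearW.
  have [Kx|Kx] := pselect (K lam x).
    rewrite (_ : fine \o _ = fun=> Q x); last first.
      apply/funext => k /=; rewrite patchE mem_set//.
      by have [+ _ _] := hPk k; exact.
    by rewrite patchE mem_set//; exact: cvg_cst.
  apply: cvg_near_cst.
  apply: filterS (Plim x Kx) => k Pkx /=.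
  by rewrite !patchE !memNset.
- have tabsQ : tame (Num.norm \o Q) by exact: tame_norm.
  have := integrable_tame tabsQ (measurable_box_radius rho') (@subset_refl _ _).
  by move=> /(integrable_mkcond _ (measurable_box_radius rho')); rewrite restrict_EFin.
- apply: filterS ae_all => x fE k _; rewrite fE /= lee_fin /g !patchE.
  case: ifPn => [/set_mem/Pbox bx|_]; first by rewrite mem_set.
  by rewrite normr0; case: ifPn => // _; exact: normr_ge0.
move=> iK _ cvgf; rewrite Rintegral_mkcond.
apply: fine_cvg; rewrite fineK//.
exact: integrable_fin_num.
Qed.
End outer_approximation.

(** * Compact convex sets and their Minkowski combinations *)

Section compact_sets.
Context {R : realType} {n : nat}.
Implicit Types A : set 'rV[R]_n.

Lemma compact_net A (e : R) : compact A -> 0 < e ->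
  exists s : seq 'rV[R]_n, (forall u, u \in s -> A u) /\
    forall x, A x -> exists2 u, u \in s & forall j, `|x ord0 j - u ord0 j| <= e.
Proof.
rewrite compact_cover => cA e0.
have [|x Ax|s sA cov] := cA _ A (fun u => ball u e).
- by move=> u _; exact: ball_open.
- by exists x => //; exact: ballxx.
exists (finmap.enum_fset s); split=> [u us|x /cov[u /= us [_ xu]]].
  by apply/set_mem/sA.
exists u => // j; rewrite distrC; exact/ltW/xu.
Qed.

Lemma compact_in_box A : compact A -> exists rho, A `<=` box rho.
Proof.
move=> cA; have [s [_ sA]] := compact_net cA ltr01.
exists (\sum_(u <- s) \sum_j `|u ord0 j| + 1) => x /sA[u us xu] j.
rewrite -[x ord0 j](subrK (u ord0 j)) (le_trans (ler_normD _ _))// addrC lerD//.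
rewrite (big_rem u)//= (bigD1 j)//= -addrA lerDl addr_ge0 ?sumr_ge0// => v _.
by rewrite sumr_ge0.
Qed.

(** A compact set is the intersection of its finite covers by cubes. *)
Lemma compact_measurable A : compact A -> measurable A.
Proof.
move=> cA; pose e_ k : R := k.+1%:R^-1.
have e0 k : 0 < e_ k by rewrite invr_gt0.
have [s hs] := choice (fun k => compact_net cA (e0 k)).
pose cube k (u : 'rV[R]_n) : set 'rV[R]_n :=
  [set x | forall j, [set z | `|z - u ord0 j| <= e_ k] (x ord0 j)].
rewrite (_ : A = \bigcap_k \bigcup_(u in [set` s k]) cube k u).
  apply: bigcapT_measurable => k.
  apply: fin_bigcup_measurable => [|u _]; first exact: finite_seq.
  apply: (@measurable_box R n (fun j => [set z | `|z - u ord0 j| <= e_ k])) => j.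
  rewrite (_ : mkset _ = `[u ord0 j - e_ k, u ord0 j + e_ k]%classic).
    exact: measurable_itv.
  by apply/seteqP; split => z /=; rewrite in_itv/= ler_distl.
apply/seteqP; split => [x Ax k _|x Sx].
  by have [_ /(_ x Ax)[u us xu]] := hs k; exists u.
apply: contrapT => Ax.
have [|eps eps0 epsx] := closed_thicken _ Ax.
  by apply: compact_closed => //; exact: norm_hausdorff.
apply: epsx; have [k ek] : exists k, e_ k <= eps.
  exists (Num.trunc eps^-1); rewrite /e_ -[leRHS]invrK lef_pV2 ?posrE ?invr_gt0//.
  exact/ltW/truncnS_gt.
have [u /= us xu] := Sx k I; exists u; first exact: (hs k).1.
by move=> j; exact: le_trans (xu j) ek.
Qed.

(** The weights are normalized by their sum, which lets the induction on the list
    of points go through. *)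
Lemma convex_set_comb A (I : eqType) (s : seq I) (P : pred I) (p : I -> R)
    (u : I -> 'rV[R]_n) : convex_set (A : set (convex_lmodType 'rV[R]_n)) ->
  (forall i, P i -> 0 <= p i) -> (forall i, P i -> A (u i)) ->
  0 < \sum_(i <- s | P i) p i ->
  A ((\sum_(i <- s | P i) p i)^-1 *: \sum_(i <- s | P i) p i *: u i).
Proof.
move=> cA p0 Au; elim: s => [|i s IH]; first by rewrite big_nil ltxx.
rewrite !big_cons; case: ifPn => // Pi; set q := \sum_(_ <- _ | _) p _ in IH *.
set v := \sum_(_ <- _ | _) _ in IH *.
have q0 : 0 <= q by apply: sumr_ge0.
move=> sum_gt0; have [q_gt0|q_le0] := ltP 0 q; last first.
  have qE : q = 0 by apply/eqP; rewrite eq_le q_le0.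
  rewrite qE addr0 in sum_gt0 *.
  rewrite (_ : v = 0) ?addr0 ?scalerA ?mulVf ?scale1r ?gt_eqF//; first exact: Au.
  rewrite /v; move/eqP: qE; rewrite /q psumr_eq0// => /allP ps.
  rewrite big1_seq// => j /andP[Pj js]; have /implyP/(_ Pj)/eqP -> := ps j js.
  by rewrite scale0r.
pose t := p i / (p i + q).
have t0 : 0 <= t by rewrite divr_ge0 ?p0// ltW.
have t1 : t <= 1 by rewrite ler_pdivrMr// mul1r lerDl.
have qt : q^-1 * (1 - t) = (p i + q)^-1.
  by rewrite /t; field; rewrite !gt_eqF.
have := cA (u i) (q^-1 *: v) (Itv01 t0 t1); rewrite !inE.
move=> /(_ (Au i Pi) (IH q_gt0)); rewrite /conv/= /unstable.onem.
by rewrite scalerDr !scalerA [(1 - t) * _]mulrC qt [_^-1 * p i]mulrC.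
Qed.

End compact_sets.

Lemma sum_option (V : nmodType) (I : finType) (F : option I -> V) :
  \sum_o F o = F None + \sum_i F (Some i).
Proof.
rewrite (bigD1 None)//=; congr (_ + _).
rewrite (reindex_omap Some id) => [|[i|]]//=.
by apply: eq_bigl => i; rewrite eqxx.
Qed.

Section generators.
Context {R : realType} {n : nat}.
Implicit Types (A : set 'rV[R]_n) (c x u : 'rV[R]_n).

(** Vertices of a simplex that contains the cube of radius e around c. *)
Definition vertex (c : 'rV[R]_n) (e : R) (o : option 'I_n) : 'rV[R]_n :=
  c - const_mx e + (if o is Some k then (2 * n%:R * e) *: delta_mx ord0 k else 0).

Lemma vertex_near c (e : R) o j : 0 <= e ->
  `|vertex c e o ord0 j - c ord0 j| <= (2 * n%:R + 1) * e.
Proof.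
move=> e0; have dE (v : 'rV[R]_n) :
    (c - const_mx e + v) ord0 j - c ord0 j = v ord0 j - e by rewrite !mxE; ring.
rewrite dE [leRHS]mulrDl mul1r (le_trans (ler_normB _ _))// [`|e|]ger0_norm// lerD2r.
have ne0 : 0 <= 2 * n%:R * e by rewrite !mulr_ge0.
case: o => [k|]; rewrite !mxE ?normr0//= normrM ger0_norm//.
by rewrite ler_piMr//; case: (_ == _); rewrite ?normr1 ?normr0.
Qed.

(** With the corner of the cube with least coordinates as origin, the coordinates
    of x lie between 0 and 2 e; the weight of an edge vertex, at distance 2 n e,
    is therefore at most 1 / n, which leaves a nonnegative weight for the
    origin. *)
Lemma cube_sub_simplex c (e : R) x : 0 < e -> (forall j, `|x ord0 j - c ord0 j| <= e) ->
  exists w : option 'I_n -> R, [/\ forall o, 0 <= w o, \sum_o w o = 1 &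
    \sum_o w o *: vertex c e o = x].
Proof.
move=> e0 xc.
pose b k := (x ord0 k - c ord0 k + e) / (2 * n%:R * e).
have n_gt0 (k : 'I_n) : 0 < n%:R :> R by rewrite ltr0n (leq_ltn_trans _ (ltn_ord k)).
have b0 k : 0 <= b k.
  rewrite divr_ge0//; last by rewrite !mulr_ge0// ltW.
  by have := xc k; rewrite ler_norml -subr_ge0 opprK => /andP[].
have b1 k : b k <= n%:R^-1.
  have nk := n_gt0 k.
  rewrite ler_pdivrMr ?mulr_gt0// mulrA mulrCA mulVf ?gt_eqF// mulr1.
  by have := xc k; rewrite ler_norml mulr_natl mulr2n lerD2r => /andP[].
have sum_b : \sum_k b k <= 1.
  apply: (@le_trans _ _ (\sum_(k < n) n%:R^-1)); first exact: ler_sum.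
  rewrite sumr_const card_ord -[X in X <= _]mulr_natr.
  by have [->|n0] := eqVneq n 0%N; rewrite ?mulr0// mulVf ?pnatr_eq0.
exists (fun o => if o is Some k then b k else 1 - \sum_k b k); split.
- by case=> [k|]; [exact: b0|rewrite subr_ge0].
- by rewrite sum_option/= subrK.
rewrite sum_option/= /vertex addr0.
under [X in _ + X]eq_bigr do rewrite scalerDr scalerA.
rewrite big_split/= -[X in _ + (X + _)]scaler_suml addrA -scalerDl subrK scale1r.
apply/rowP => j; rewrite !mxE summxE (bigD1 j)//= !mxE !eqxx big1 => [|k kj].
  have nj := n_gt0 j; rewrite /b mulr1 addr0 divfK ?mulf_neq0 ?gt_eqF//; ring.
by rewrite !mxE eqxx/= eq_sym (negbTE kj) mulr0.
Qed.

(** Cover the set by small cubes centred in it and replace every cube by the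
    vertices of a simplex around it. *)
Lemma finite_outer_hull A (e : R) : compact A -> A !=set0 -> 0 < e ->
  exists (T : finType) (t0 : T) (g : T -> 'rV[R]_n),
    (forall t, exists2 u, A u & forall j, `|g t ord0 j - u ord0 j| <= e) /\
    forall x, A x -> exists w : T -> R,
      [/\ forall t, 0 <= w t, \sum_t w t = 1 & \sum_t w t *: g t = x].
Proof.
move=> cA [x0 Ax0] e0; pose M : R := 2 * n%:R + 1.
have M0 : 0 < M by rewrite ltr_wpDl// mulr_ge0.
have eM : 0 < e / M by rewrite divr_gt0.
have [s [sA netA]] := compact_net cA eM.
have [v vs _] := netA _ Ax0.
have s0 : (0 < size s)%N by case: (s) vs.
exists ('I_(size s) * option 'I_n)%type, (Ordinal s0, None),
  (fun t : 'I_(size s) * option 'I_n => vertex (nth 0 s t.1) (e / M) t.2); split.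
  move=> [i o]; exists (nth 0 s i); first exact/sA/mem_nth.
  move=> j; apply: le_trans (vertex_near _ _ _ (ltW eM)) _.
  by rewrite mulrC divfK ?gt_eqF.
move=> x /netA[u us xu]; have is_ : (index u s < size s)%N by rewrite index_mem.
have [w [w0 w1 wx]] := cube_sub_simplex eM xu.
exists (fun t => if t.1 == Ordinal is_ then w t.2 else 0); split.
- by move=> [i o] /=; case: ifP.
- rewrite -(pair_bigA _ (fun i o => if i == Ordinal is_ then w o else 0))/=.
  rewrite (bigD1 (Ordinal is_))//= eqxx w1 big1 ?addr0// => i ii.
  by rewrite (negbTE ii) big1.
rewrite -(pair_bigA _ (fun i o => (if i == Ordinal is_ then w o else 0) *:
  vertex (nth 0 s i) (e / M) o))/=.
rewrite (bigD1 (Ordinal is_))//= eqxx nth_index// wx big1 ?addr0// => i ii.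
by rewrite (negbTE ii) big1// => o _; rewrite scale0r.
Qed.

End generators.

Section Minkowski_combinations.
Context {R : realType} {n : nat}.

Lemma Minkowski_combP r (lam : 'I_r -> R) (D : 'I_r -> set 'rV[R]_n) x :
  Minkowski_comb lam D x <->
  exists2 u : 'I_r -> 'rV[R]_n, (forall i, D i (u i)) & x = \sum_i lam i *: u i.
Proof.
elim: r lam D x => [|r IH] lam D x; rewrite /Minkowski_comb.
  rewrite big_ord0; split=> [->|[u _]]; last by rewrite big_ord0.
  by exists (fun=> 0); [case|rewrite big_ord0].
rewrite big_ord_recl; split.
  move=> [_ [u0 Du0 <-]] [y /IH[u Du ->] <-].
  exists (fun i => oapp u u0 (unlift ord0 i)).
    by move=> i; case: unliftP => [j|] ->; [exact: Du|].
  by rewrite big_ord_recl unlift_none/=; under [in RHS]eq_bigr do rewrite liftK.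
move=> [u Du ->]; exists (lam ord0 *: u ord0); first by exists (u ord0).
exists (\sum_(i < r) lam (lift ord0 i) *: u (lift ord0 i)).
  by apply/IH; exists (fun i => u (lift ord0 i)).
by rewrite big_ord_recl.
Qed.

Lemma compact_Minkowski_comb r (lam : 'I_r -> R) (D : 'I_r -> set 'rV[R]_n) :
  (forall i, compact (D i)) -> compact (Minkowski_comb lam D).
Proof.
move=> cD; apply: big_ind => [|A B cA cB|i _]; first exact: compact_set1.
- rewrite (_ : Minkowski_add A B = (fun p => p.1 + p.2) @` (A `*` B)).
    apply: continuous_compact; last exact: compact_setX.
    exact/continuous_subspaceT/add_continuous.
  apply/seteqP; split => [_ [u Au [v Bv <-]]|_ [[u v] [Au Bv] <-]].
    by exists (u, v).
  by exists u => //; exists v.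
apply: continuous_compact => //.
by apply/continuous_subspaceT => v; exact: scaler_continuous.
Qed.

(** Weights that represent each summand give a representation of the combination
    after multiplication by lam.  Conversely, moving each generator to a nearby
    point of its body moves the represented point by at most e times the total
    weight, and convexity gathers each block into one point of its body. *)
Lemma outer_polytopes r (D : 'I_r -> set 'rV[R]_n) (e : R) : (0 < r)%N ->
  (forall i, compact (D i)) -> (forall i, D i !=set0) ->
  (forall i, convex_set (D i : set (convex_lmodType 'rV[R]_n))) -> 0 < e ->
  exists (T : finType) (t0 : T) (a : T -> 'rV[R]_n) (beta : T -> 'I_r),
    forall lam, positive lam ->
      Minkowski_comb lam D `<=` in_polytope a beta lam /\
      in_polytope a beta lam `<=` thicken (Minkowski_comb lam D) (e * \sum_i lam i).
Proof.
move=> r0 cD D0 convD e0.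
have h i := cid (finite_outer_hull (cD i) (D0 i) e0).
pose T_ i : finType := projT1 (h i).
have h' i := cid (projT2 (h i)); have h'' i := cid (projT2 (h' i)).
pose g i : T_ i -> 'rV[R]_n := projT1 (h'' i).
have gnear i t : exists2 u, D i u & forall j, `|g i t ord0 j - u ord0 j| <= e.
  by have [+ _] := projT2 (h'' i); exact.
have ghull i x : D i x -> exists w : T_ i -> R,
    [/\ forall t, 0 <= w t, \sum_t w t = 1 & \sum_t w t *: g i t = x].
  by have [_ +] := projT2 (h'' i); exact.
pose T : finType := {i : 'I_r & T_ i}.
pose a (t : T) := g (tag t) (tagged t); pose beta (t : T) := tag t.
exists T, (Tagged T_ (projT1 (h' (Ordinal r0)))), a, beta => lam lam0; split.
  move=> x /Minkowski_combP[u Du ->].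
  have W i := cid (ghull i (u i) (Du i)).
  exists (fun t => lam (tag t) * projT1 (W (tag t)) (tagged t)).
  apply/nonneg_combP; split=> [t||i].
  - by have [w0 _ _] := projT2 (W (tag t)); rewrite mulr_ge0// ltW.
  - rewrite -(sig_big_dep xpredT (fun _ => xpredT)
      (fun i t => (lam i * projT1 (W i) t) *: g i t))/=.
    apply: eq_bigr => i _; have [_ _ {2}<-] := projT2 (W i).
    by rewrite scaler_sumr; apply: eq_bigr => t _; rewrite scalerA.
  rewrite (eq_bigl (fun t : T => (tag t == i) && true)); last first.
    by move=> t; rewrite andbT.
  rewrite -(sig_big_dep (pred1 i) (fun _ => xpredT)
    (fun i t => lam i * projT1 (W i) t))/= big_pred1_eq -mulr_sumr.
  by have [_ -> _] := projT2 (W i); rewrite mulr1.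
move=> x [y /nonneg_combP[y0 yx yl]].
have /choice[u hu] : forall t : T, exists v, D (beta t) v /\
    forall j, `|a t ord0 j - v ord0 j| <= e.
  by move=> t; have [v Dv av] := gnear (tag t) (tagged t); exists v.
pose d i := (lam i)^-1 *: \sum_(t | beta t == i) y t *: u t.
exists (\sum_i lam i *: d i).
  apply/Minkowski_combP; exists d => // i; rewrite /d -yl.
  apply: convex_set_comb => //; last by rewrite yl.
  by move=> t /eqP <-; exact: (hu t).1.
have -> : \sum_i lam i *: d i = \sum_t y t *: u t.
  rewrite [RHS](partition_big beta xpredT)//=; apply: eq_bigr => i _.
  by rewrite /d scalerA mulfV ?gt_eqF// scale1r.
move=> j; rewrite -yx !summxE -sumrB (le_trans (ler_norm_sum _ _ _))//.
have -> : e * \sum_i lam i = \sum_t y t * e.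
  rewrite -mulr_suml mulrC [in RHS](partition_big beta xpredT)//=; congr (_ * _).
  by apply: eq_bigr => i _; rewrite yl.
apply: ler_sum => t _; rewrite !mxE -mulrBr normrM ger0_norm//.
by rewrite ler_wpM2l// (hu t).2.
Qed.

End Minkowski_combinations.

(** * Monomials and polynomials *)

Section monomials.
Context {R : realType} {n : nat}.

Definition monomial (m : 'I_n -> nat) (v : 'rV[R]_n) : R :=
  \prod_i v ord0 i ^+ m i.

Lemma tame_monomial (m : 'I_n -> nat) :
  tame (monomial m).
Proof.
apply: tame_big => [|i]; first exact: tameM.
elim: (m i) => [|k IH]; first by under eq_fun do rewrite expr0; exact: tame_cst.
by under eq_fun do rewrite exprS; apply: tameM => //; exact: tame_coord.
Qed.

Lemma hpoly_monomial r (m : 'I_n -> nat) (phi : ('I_r -> R) -> 'rV[R]_n) :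
  (forall i, hpoly 1 (fun lam => phi lam ord0 i)) ->
  hpoly (\sum_i m i) (fun lam => monomial m (phi lam)).
Proof.
move=> hphi; apply: hpoly_prod => i.
by have := hpolyX (m i) (hphi i); rewrite muln1.
Qed.

Lemma hpoly_monomial_integral r (D : 'I_r -> set 'rV[R]_n) (m : 'I_n -> nat) :
  (0 < r)%N -> (forall i, compact (D i)) -> (forall i, D i !=set0) ->
  (forall i, convex_set (D i : set (convex_lmodType 'rV[R]_n))) ->
  hpoly (\sum_i m i + n) (fun lam =>
    \int[lebesgue_rV n]_(x in Minkowski_comb lam D) monomial m x).
Proof.
move=> r0 cD D0 convD; apply: hpoly_outer_approximation => [|phi|lam _|e e0].
- exact: tame_monomial.
- exact: hpoly_monomial.
- have cK := compact_Minkowski_comb (lam := lam) cD; split.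
  + exact: compact_measurable.
  + by apply: compact_closed => //; exact: norm_hausdorff.
  + exact: compact_in_box.
- exact: outer_polytopes.
Qed.

End monomials.

Lemma integral_over_monomials (R : realType) n (Q : mpoly.mpoly n R) K :
  compact K -> integral_over Q K =
  \sum_(m <- mpoly.msupp Q) mpoly.mcoeff m Q *
    \int[lebesgue_rV n]_(x in K) monomial m x.
Proof.
move=> cK; have mK := compact_measurable cK; have [rho Krho] := compact_in_box cK.
have im (m : 'I_n -> nat) : (lebesgue_rV n).-integrable K
    (EFin \o monomial m).
  exact: (integrable_tame (tame_monomial m) mK Krho).
transitivity (\int[lebesgue_rV n]_(x in K)
    (\sum_(m <- mpoly.msupp Q) mpoly.mcoeff m Q * monomial m x)).
  by apply: eq_Rintegral => x _; rewrite mpoly.mevalE.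
rewrite (Rintegral_sum mK _).2.
  by apply: eq_bigr => m _; rewrite RintegralZl.
move=> m _; rewrite (_ : _ \o _ = fun x =>
    ((mpoly.mcoeff m Q)%:E * (monomial m x)%:E)%E).
  exact: integrableZl (im m).
by apply/funext => x /=; rewrite EFinM.
Qed.

(** One polynomial per monomial, of a degree that depends on the monomial only,
    covers both bounds on the degree of Q. *)
Lemma integral_over_polynomial (R : realType) n (Q : mpoly.mpoly n R) r
    (D : 'I_r -> set 'rV[R]_n) : (0 < r)%N ->
  (forall i, strictly_convex_smooth (D i)) ->
  exists p : mpoly.multinom n -> mpoly.mpoly r R,
    (forall m, mpoly_homogeneous (mpoly.mdeg m + n) (p m)) /\
    forall lam : 'I_r -> R, (forall i, 0 < lam i) ->
      integral_over Q (Minkowski_comb lam D) = mpoly.meval lam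
        (\sum_(m <- mpoly.msupp Q) mpoly.mcoeff m Q *: p m).
Proof.
move=> r0 hD.
have cD i : compact (D i) by have [[]] := hD i.
have convD i : convex_set (D i : set (convex_lmodType 'rV[R]_n)).
  by have [[]] := hD i.
have D0 i : D i !=set0.
  by have [[_ _ [x /interior_subset Dx]]] := hD i; exists x.
have /choice[p hp] : forall m : mpoly.multinom n, exists p : mpoly.mpoly r R,
    mpoly_homogeneous (mpoly.mdeg m + n) p /\
    forall lam : 'I_r -> R, (forall i, 0 < lam i) ->
    \int[lebesgue_rV n]_(x in Minkowski_comb lam D) monomial m x =
    mpoly.meval lam p.
  move=> m; have [p hp pE] := hpoly_monomial_integral m r0 cD D0 convD.
  by exists p; split => //; rewrite mpoly.mdegE.
exists p; split=> [m|lam lam0]; first exact: (hp m).1.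
rewrite integral_over_monomials; last exact: compact_Minkowski_comb.
rewrite raddf_sum; apply: eq_bigr => m _.
by rewrite /= mpoly.mevalZ (hp m).2.
Qed.

Theorem corollary2p5 (R : realType) (n k : nat) (Q : mpoly.mpoly n R) :
  (mpoly_degree_le k Q ->
   polynomial_of_degree_le (k + n) strictly_convex_smooth (integral_over Q)) /\
  (mpoly_homogeneous k Q ->
   homogeneous_polynomial (k + n) strictly_convex_smooth (integral_over Q)).
Proof.
split=> hQ r D r0 hD; have [p [hp pE]] := integral_over_polynomial Q r0 hD.
- exists (\sum_(m <- mpoly.msupp Q) mpoly.mcoeff m Q *: p m) => //.
  rewrite /mpoly_degree_le big_seq; apply: (big_ind (fun q =>
    (mpoly.msize q <= (k + n).+1)%N)) => [|q1 q2 h1 h2|m mQ].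
  + by rewrite mpoly.msize0.
  + by rewrite (leq_trans (mpoly.msizeD_le _ _))// geq_max h1.
  + rewrite (leq_trans (mpoly.msizeZ_le _ _))// mpoly.msizeE.
    apply/bigmax_leqP_seq => m' m'p _; rewrite (mpoly.dhomog_mf (hp m) m'p).
    by rewrite ltnS leq_add2r -ltnS (leq_trans (mpoly.msize_mdeg_lt mQ)).
- exists (\sum_(m <- mpoly.msupp Q) mpoly.mcoeff m Q *: p m) => //.
  rewrite /mpoly_homogeneous big_seq; apply: rpred_sum => m mQ.
  by apply: mpoly.dhomogZ; rewrite -(mpoly.dhomog_mf hQ mQ); exact: hp.
Qed.
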